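(* Let $P$ be a probability measure on $\mathbb{R}^p$ that is absolutely continuous with respect to the Lebesgue measure, with density $f$. Then the following hold. (i) For Lebesgue-almost every $x\in\mathbb{R}^p$, $$\lim_{\tau\to 0^+}\frac{1}{\tau^{2p}\Lambda_1}LLD(x,\tau)=f^2(x).$$ Furthermore, if $f$ is continuous, then this holds for all $x\in\mathbb{R}^p$. (ii) Suppose that $f$ is three times continuously differentiable. Then for every $x\in\mathbb{R}^p$ $$\lim_{\tau\to 0^+}\frac{1}{\tau^2}\left(\frac{1}{\tau^{2p}}LLD(x,\tau)-\Lambda_1 f^2(x)\right)=h(x),$$ where $$h(x)=f(x)\int_{Z_1(0)}x_1^{\top}H_f(x)x_1\,dx_1dx_2+\int_{Z_1(0)}\langle\nabla f(x),x_1\rangle\langle\nabla f(x),x_2\rangle\,dx_1dx_2 .$$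
   Context: $p\ge 1$; $\|\cdot\|$ and $\langle\cdot,\cdot\rangle$ are the Euclidean norm and inner product on $\mathbb{R}^p$. For $x\in\mathbb{R}^p$ and $\tau\in[0,\infty]$, $$Z_\tau(x)=\{(x_1,x_2)\in\mathbb{R}^p\times\mathbb{R}^p:\ \max_{i=1,2}\|x-x_i\|\le\|x_1-x_2\|\le\tau\}.$$ The local lens depth of $x$ with respect to $P$ is $LLD(x,\tau)=\int_{\mathbb{R}^p\times\mathbb{R}^p}\mathbf{I}((x_1,x_2)\in Z_\tau(x))\,dP(x_1)\,dP(x_2)$. $\Lambda_1$ is the Lebesgue measure of $Z_1(0)$ in $\mathbb{R}^p\times\mathbb{R}^p$. $\nabla f$ and $H_f$ denote the gradient and the Hessian matrix of $f$. *)

(* Defs.v *)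
From HB Require Import structures.
From mathcomp Require Import all_boot all_order all_algebra.
From mathcomp Require Import all_classical all_reals all_analysis.
From mathcomp Require Import measurable_realfun.

Set Implicit Arguments.
Unset Strict Implicit.
Unset Printing Implicit Defensive.

Import Order.TTheory GRing.Theory Num.Theory.
Import numFieldNormedType.Exports.

Local Open Scope classical_set_scope.
Local Open Scope ring_scope.

(* The sigma-algebra on R^n is the one generated by the coordinates, as the
   library does for n.-tuple; it is the Borel one, see measurable_rV_borel. *)
Definition rV_display : measure_display. Proof. exact: default_measure_display. Qed.

Section measurable_rV.
Variables (R : realType) (n : nat).

Definition rV_coord (i : 'I_n) (x : 'rV[R]_n) : measurableTypeR R := x 0 i.

Let rV_set0 : g_sigma_preimage rV_coord set0.
Proof. exact: sigma_algebra0. Qed.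

Let rV_setC A : g_sigma_preimage rV_coord A -> g_sigma_preimage rV_coord (~` A).
Proof. exact: sigma_algebraC. Qed.

Let rV_bigcup (F : _^nat) : (forall i, g_sigma_preimage rV_coord (F i)) ->
  g_sigma_preimage rV_coord (\bigcup_i (F i)).
Proof. exact: sigma_algebra_bigcup. Qed.

HB.instance Definition _ := @isMeasurable.Build rV_display
  'rV[R]_n (g_sigma_preimage rV_coord) rV_set0 rV_setC rV_bigcup.

Lemma measurable_rV_coord (i : 'I_n) : measurable_fun [set: 'rV[R]_n] (rV_coord i).
Proof.
move=> _ Y mY; rewrite setTI; apply: sub_sigma_algebra => /=.
rewrite -bigcup_seq/=; exists i => /=; first by rewrite mem_index_enum.
by exists Y => //; rewrite setTI.
Qed.

Lemma measurable_fun_rVP d (T : measurableType d) (f : T -> 'rV[R]_n) :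
  (forall i, measurable_fun [set: T] (rV_coord i \o f)) ->
  measurable_fun [set: T] f.
Proof.
move=> mf; have H : g_sigma_preimage (fun i => rV_coord i \o f) `<=` measurable.
  apply: smallest_sub; first exact: sigma_algebra_measurable.
  rewrite -bigcup_seq; apply: bigcup_sub => i _.
  by move=> A [B mB <-]; exact: mf.
move=> _ Y mY; apply: H; rewrite g_sigma_preimage_comp.
by exists Y.
Qed.

End measurable_rV.

Section lebesgue_rV.
Variable R : realType.

Definition rV_cons n (z : measurableTypeR R * 'rV[R]_n) : 'rV[R]_n.+1 :=
  row_mx (const_mx z.1 : 'rV[R]_1) z.2.

Lemma measurable_rV_cons n : measurable_fun setT (@rV_cons n).
Proof.
apply: measurable_fun_rVP => i.
have [j ->|j ->] := @split_ordP 1 n i.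
- rewrite (_ : _ \o _ = fst); first exact: measurable_fst.
  by apply/funext => z /=; rewrite /rV_coord /rV_cons (@row_mxEl _ _ 1 n) mxE.
- rewrite (_ : _ \o _ = @rV_coord R n j \o snd).
    exact: measurableT_comp (measurable_rV_coord j) measurable_snd.
  by apply/funext => z /=; rewrite /rV_coord /rV_cons (@row_mxEr _ _ 1 n).
Qed.

Section cons_measure.
Variables (n : nat) (mu : {sigma_finite_measure set 'rV[R]_n -> \bar R}).

Local Notation leb := (@lebesgue_measure R).

Definition cons_measure : set 'rV[R]_n.+1 -> \bar R :=
  pushforward (leb \x mu)%E (@rV_cons n).

Let m_cons := @measurable_rV_cons n.

Let cons0 : cons_measure set0 = 0%E.
Proof. by rewrite /cons_measure /pushforward preimage_set0 measure0. Qed.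

Let cons_ge0 A : (0 <= cons_measure A)%E.
Proof. exact: measure_ge0. Qed.

Let cons_sigma_additive : semi_sigma_additive cons_measure.
Proof.
move=> F mF tF mUF; rewrite /cons_measure /pushforward preimage_bigcup.
apply: measure_semi_sigma_additive.
- by move=> k; rewrite -[X in measurable X]setTI; exact: m_cons.
- apply/trivIsetP => /= i j _ _ ij; rewrite -preimage_setI.
  by move/trivIsetP : tF => /(_ _ _ _ _ ij) ->//; rewrite preimage_set0.
- by rewrite -preimage_bigcup -[X in measurable X]setTI; exact: m_cons.
Qed.

HB.instance Definition _ := isMeasure.Build _ _ _ cons_measure
  cons0 cons_ge0 cons_sigma_additive.

Let cons_sigma_finite : sigma_finite setT cons_measure.
Proof.
have /sigma_finiteP[F [TF ndF Foo]] := sigma_finiteT leb.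
have /sigma_finiteP[G [TG ndG Goo]] := sigma_finiteT mu.
pose uncons (x : 'rV[R]_(1 + n)) : measurableTypeR R * 'rV[R]_n :=
  (lsubmx x 0 0, rsubmx x).
have m_uncons : measurable_fun setT uncons.
  apply: measurable_fun_pair.
    rewrite (_ : (fun _ => _) = @rV_coord R (1 + n) (lshift n ord0)).
      exact: measurable_rV_coord.
    by apply/funext => x; rewrite mxE.
  apply: measurable_fun_rVP => i.
  rewrite (_ : _ \o _ = @rV_coord R (1 + n) (rshift 1 i)).
    exact: measurable_rV_coord.
  by apply/funext => x; rewrite /rV_coord /= mxE.
exists (fun k => uncons @^-1` (F k `*` G k)).
  rewrite -preimage_bigcup (_ : \bigcup_k _ = setT) ?preimage_setT//.
  apply/seteqP; split => // -[x y] _.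
  have [k _ Fkx] : (\bigcup_k F k) x by rewrite -TF.
  have [l _ Gly] : (\bigcup_k G k) y by rewrite -TG.
  exists (maxn k l) => //; split.
  - by move: x Fkx; exact/subsetPset/ndF/leq_maxl.
  - by move: y Gly; exact/subsetPset/ndG/leq_maxr.
move=> k; have [mFk Fkoo] := Foo k; have [mGk Gkoo] := Goo k; split.
  rewrite -[X in measurable X]setTI; apply: m_uncons => //.
  exact: measurableX.
rewrite /cons_measure /pushforward (_ : _ @^-1` _ = F k `*` G k).
  by rewrite product_measure1E// lte_mul_pinfty// ge0_fin_numE.
apply/seteqP; split => -[a y]; rewrite /preimage /uncons /rV_cons /=;
  by rewrite row_mxKl row_mxKr mxE.
Qed.

HB.instance Definition _ := Measure_isSigmaFinite.Build _ _ _ cons_measure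
  cons_sigma_finite.

End cons_measure.

(* the n-fold product of the Lebesgue measure on R; lebesgue_rV_box below gives
   its value on boxes *)
Fixpoint lebesgue_rV (n : nat) : {sigma_finite_measure set 'rV[R]_n -> \bar R} :=
  if n is m.+1 then cons_measure (lebesgue_rV m) else \d_ (0 : 'rV[R]_0).

End lebesgue_rV.

Section lebesgue_rV_characterization.
Variable R : realType.
Local Notation leb1 := (@lebesgue_measure R).

Lemma lebesgue_rV_box n (A : 'I_n -> set (measurableTypeR R)) :
  (forall i, measurable (A i)) ->
  lebesgue_rV R n [set x : 'rV[R]_n | forall i, A i (x 0 i)] = (\prod_(i < n) leb1 (A i))%E.
Proof.
elim: n A => [|n IH] A mA.
  have -> : [set x : 'rV[R]_0 | forall i, A i (x 0 i)] = setT.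
    by apply/seteqP; split => // x _ [].
  by rewrite big_ord0 /= diracT.
rewrite big_ord_recl -(IH (fun i => A (lift ord0 i)))//.
rewrite [LHS]/= /cons_measure /pushforward.
rewrite (_ : _ @^-1` _ =
    A ord0 `*` [set x : 'rV[R]_n | forall i, A (lift ord0 i) (x 0 i)]).
  rewrite product_measure1E//.
  rewrite (_ : [set x : 'rV[R]_n | _] = \bigcap_(i in [set: 'I_n])
      (@rV_coord R n i @^-1` A (lift ord0 i))); last first.
    by apply/seteqP; split => x /= Ax i; [move=> _; exact: Ax|exact: Ax i I].
  apply: fin_bigcap_measurable => // i _.
  by rewrite -[X in measurable X]setTI; exact: measurable_rV_coord.
have E0 (z : measurableTypeR R * 'rV[R]_n) : rV_cons z 0 ord0 = z.1.
  rewrite /rV_cons (_ : ord0 = lshift n (ord0 : 'I_1)) ?(@row_mxEl _ _ 1 n) ?mxE//.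
  exact/val_inj.
have EL (z : measurableTypeR R * 'rV[R]_n) i : rV_cons z 0 (lift ord0 i) = z.2 0 i.
  rewrite /rV_cons (_ : lift ord0 i = rshift 1 i) ?(@row_mxEr _ _ 1 n)//.
  exact/val_inj.
apply/seteqP; split => z /=.
  by move=> Az; split => [|i]; [rewrite -E0|rewrite -EL]; exact: Az.
move=> [A0 AL] i; have [j ->|->] := unliftP ord0 i; first by rewrite EL.
by rewrite E0.
Qed.

Lemma measurable_rV_borel n :
  @measurable _ 'rV[R]_n = <<s (@open 'rV[R]_n) >>.
Proof.
apply/seteqP; split.
  apply: smallest_sub; first exact: smallest_sigma_algebra.
  rewrite -bigcup_seq; apply: bigcup_sub => i _ _ [B mB <-].
  have : measurable_fun [set: g_sigma_algebraType (@open 'rV[R]_n)]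
      (@rV_coord R n i : g_sigma_algebraType (@open 'rV[R]_n) -> measurableTypeR R).
    apply: (measurability _ (RGenOpens.measurableE R)) => _ [_ [a [b ->]] <-].
    apply: sub_sigma_algebra; rewrite setTI.
    apply: open_comp; last exact: interval_open.
    by move=> x _; exact: coord_continuous.
  by move=> /(_ measurableT B mB).
apply: smallest_sub; first exact: sigma_algebra_measurable.
move=> U oU.
pose box (q : 'rV[rat]_n * nat) := \bigcap_(i in [set: 'I_n])
  (@rV_coord R n i @^-1` ball (ratr (q.1 0 i) : R) q.2.+1%:R^-1).
have -> : U = \bigcup_q (if `[< box q `<=` U >] then box q else set0).
  apply/seteqP; split=> x; last first.
    by move=> [q _]; case: asboolP => // qU xq; exact: qU.
  move=> Ux; have /nbhs_ballP[e e0 eU] : nbhs x U by exact: open_nbhs_nbhs.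
  have [k ke] : exists k, 2 * k.+1%:R^-1 < e :> R.
    have [k _ /(_ k)] := near_infty_natSinv_lt (PosNum (divr_gt0 e0 (@ltr0Sn R 1))).
    move=> /(_ (leqnn k)) /= ke; exists k.
    by rewrite mulrC -ltr_pdivlMr.
  pose d : R := k.+1%:R^-1; have d0 : 0 < d by rewrite invr_gt0 ltr0n.
  have /choice[q qx] : forall i : 'I_n, exists q : rat, `|ratr q - x 0 i| < d.
    move=> i; have [|q] := @rat_in_itvoo R (x 0 i - d) (x 0 i + d).
      by rewrite ltrD2l gtrN.
    by rewrite in_itv/= => qi; exists q; rewrite distrC ltr_distlC.
  exists (\row_i q i, k) => //=; case: asboolP => [_ i _|[]].
    by rewrite /= mxE /rV_coord -ball_normE/=.
  move=> y yq; apply: eU; split => // i j; rewrite ord1.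
  have := yq j I; rewrite /= mxE /rV_coord -!ball_normE /= => yj.
  apply: (le_lt_trans (ler_distD (ratr (q j)) _ _)).
  apply: lt_trans ke; rewrite mulr_natl mulr2n ltrD//.
  by rewrite distrC.
apply: countable_bigcupT_measurable => [|q]; first exact: countableP.
case: asboolP => // _; apply: fin_bigcap_measurable => // i _.
rewrite -[X in measurable X]setTI; apply: measurable_rV_coord => //.
exact: measurable_ball.
Qed.

End lebesgue_rV_characterization.

Section lens_depth.
Variables (R : realType) (p : nat).
Local Notation Rp := 'rV[R]_p.
Local Notation leb := (@lebesgue_rV R p).

Definition inner (x y : Rp) : R := \sum_(i < p) x 0 i * y 0 i.

(* The library's norm on 'rV[R]_p is the sup norm; its topology is the usual
   one, so limits, continuity and derivatives below use it. *)
Definition eucl_norm (x : Rp) : R := Num.sqrt (inner x x).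

Definition Zset (tau : \bar R) (x : Rp) : set (Rp * Rp) :=
  [set z | Num.max (eucl_norm (x - z.1)) (eucl_norm (x - z.2))
             <= eucl_norm (z.1 - z.2)
           /\ ((eucl_norm (z.1 - z.2))%:E <= tau)%E].

Definition LLD (P : probability Rp R) (x : Rp) (tau : \bar R) : R :=
  \int[(P \x P)%E]_z \1_(Zset tau x) z.

Definition Lambda1 : R := fine ((leb \x leb)%E (Zset 1%:E 0)).

Definition is_density (P : probability Rp R) (f : Rp -> R) : Prop :=
  [/\ measurable_fun setT f, (forall x, 0 <= f x) &
      forall A, measurable A -> P A = (\int[leb]_(x in A) (f x)%:E)%E].

Definition partial (i : 'I_p) (f : Rp -> R) : Rp -> R :=
  fun x => 'D_(delta_mx 0 i) f x.

(* f is C^(k.+1) iff f is Fréchet differentiable everywhere and its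
   differential, given by the partial derivatives, is C^k *)
Fixpoint Cdiff (k : nat) (f : Rp -> R) : Prop :=
  if k is k'.+1 then
    (forall x, differentiable f x) /\ forall i, Cdiff k' (partial i f)
  else continuous f.

Definition gradient (f : Rp -> R) (x : Rp) : Rp := \row_i partial i f x.

Definition hessian (f : Rp -> R) (x : Rp) : 'M[R]_p :=
  \matrix_(i, j) partial i (partial j f) x.

(* vectors are rows, so the quadratic form x1^T H x1 reads x1 *m H *m x1^T *)
Definition hfun (f : Rp -> R) (x : Rp) : R :=
  f x * \int[(leb \x leb)%E]_(z in Zset 1%:E 0)
          (z.1 *m hessian f x *m z.1^T) 0 0
  + \int[(leb \x leb)%E]_(z in Zset 1%:E 0)
      (inner (gradient f x) z.1 * inner (gradient f x) z.2).

End lens_depth.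
Arguments Lambda1 : clear implicits.

(* Main.v *)
Require Import Defs.
From HB Require Import structures.
From mathcomp Require Import all_boot all_order all_algebra.
From mathcomp Require Import all_classical all_reals all_analysis.
From mathcomp Require Import measurable_realfun ring lra.

Import Order.TTheory GRing.Theory Num.Theory.
Import numFieldNormedType.Exports.

Set Implicit Arguments.
Unset Strict Implicit.
Unset Printing Implicit Defensive.

Local Open Scope classical_set_scope.
Local Open Scope ring_scope.

(** Under the substitution x_i = x + tau y_i the set Z_tau(x) becomes Z_1(0) and
    the Lebesgue measure of R^p x R^p is multiplied by tau^(2p), hence
      tau^(-2p) LLD(x, tau)
        = int_{Z_1(0)} f(x + tau y_1) f(x + tau y_2) dy_1 dy_2
    (LLD_rescaled).  The domain of integration no longer depends on tau, and is
    bounded, so that the statements concern the behaviour of f near x.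

    First order.  Let D(tau) be the integral of |f(x + tau y) - f(x)| over a
    fixed ball B containing the unit ball.  Comparing the integrand with f(x)^2
    and integrating over B x B instead of Z_1(0), the integral above differs from
    Lambda_1 f(x)^2 by at most D^2 + 2 f(x) |B| D (rescaled_integral_bound).  This
    tends to 0 as soon as D does, that is, at the Lebesgue points of f.  Points
    of continuity are Lebesgue points; for an integrable f almost every point is
    one (ae_lebesgue_point).  The latter is the Lebesgue differentiation theorem
    in R^n.  It rests on the fact that a finite measure that vanishes on A has
    density 0 at almost every point of A (null_set_density0), which follows from
    outer regularity and from Vitali's covering argument for cubes, the balls of
    the sup norm.  It is applied to the measures whose density is the restriction
    of |f - q|, for q rational, to the set where it is at least 1/(k+1).  Finally
    one divides by Lambda_1, which is positive because Z_1(0) contains a product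
    of two boxes (Lambda1_gt0).

    Second order.  Taylor's formula, with a remainder o(tau^2) that is uniform for
    y in B (taylor2_uniform), gives an expansion of the product
    f(x + tau y_1) f(x + tau y_2).  Since Z_1(0) is invariant under
    (y_1, y_2) |-> (-y_1, -y_2), the terms of order 1 integrate to 0
    (integral_linear_Z1); since it is invariant under the exchange of y_1 and y_2,
    the two Hessian terms, each with a coefficient f(x) / 2, have equal integrals.
    The coefficient of tau^2 is therefore h(x). *)

(** * Measures with a density *)

Section density_measure.
Context d (T : measurableType d) (R : realType).
Variables (mu : {measure set T -> \bar R}) (g : T -> R).
Hypotheses (mg : measurable_fun setT g) (g0 : forall x, 0 <= g x).
Local Open Scope ereal_scope.

(** The proofs of measurability and positivity are arguments, so that the
    canonical structure of measure can be inferred. *)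
Definition density_measure of measurable_fun setT g & (forall x, (0 <= g x)%R) :
  set T -> \bar R := fun A => \int[mu]_(x in A) (g x)%:E.

Local Notation nu := (density_measure mg g0).

Let nu0 : nu set0 = 0.
Proof. exact: integral_set0. Qed.

Let nu_ge0 A : 0 <= nu A.
Proof. by apply: integral_ge0 => x _; rewrite lee_fin. Qed.

Let nu_sigma_additive : semi_sigma_additive nu.
Proof.
move=> F mF tF mUF; rewrite /density_measure ge0_integral_bigcup//.
- apply: is_cvg_nneseries => n _ _.
  by apply: integral_ge0 => x _; rewrite lee_fin.
- by apply/measurable_EFinP; exact: measurable_funTS.
- by move=> x _; rewrite lee_fin.
Qed.

HB.instance Definition _ := isMeasure.Build _ _ _ nu nu0 nu_ge0 nu_sigma_additive.

End density_measure.

Section product_density.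
Context d1 d2 (T1 : measurableType d1) (T2 : measurableType d2) (R : realType).
Variables (l1 : {sigma_finite_measure set T1 -> \bar R}).
Variables (l2 : {sigma_finite_measure set T2 -> \bar R}).
Local Open Scope ereal_scope.

Lemma integral_tensor (g1 : T1 -> R) (g2 : T2 -> R) A B :
  measurable_fun setT g1 -> measurable_fun setT g2 ->
  (forall x, 0 <= g1 x)%R -> (forall x, 0 <= g2 x)%R ->
  measurable A -> measurable B ->
  \int[l1 \x l2]_(z in A `*` B) (g1 z.1 * g2 z.2)%:E =
  (\int[l1]_(x in A) (g1 x)%:E) * (\int[l2]_(x in B) (g2 x)%:E).
Proof.
move=> mg1 mg2 g10 g20 mA mB.
have mAB : measurable (A `*` B) by exact: measurableX.
rewrite integral_mkcond.
have -> : ((fun z : T1 * T2 => (g1 z.1 * g2 z.2)%:E) \_ (A `*` B)) =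
    (fun z => ((g1 \_ A) z.1 * (g2 \_ B) z.2)%:E).
  apply/funext => -[x y]; rewrite /patch in_setX /=.
  by case: (x \in A) => /=; case: (y \in B); rewrite ?mulr0 ?mul0r.
have m1 : measurable_fun setT (g1 \_ A).
  by apply/(measurable_restrictT g1) => //; exact: measurable_funTS.
have m2 : measurable_fun setT (g2 \_ B).
  by apply/(measurable_restrictT g2) => //; exact: measurable_funTS.
have p1 x : (0 <= (g1 \_ A) x)%R by rewrite /patch; case: ifP.
have p2 x : (0 <= (g2 \_ B) x)%R by rewrite /patch; case: ifP.
rewrite fubini_tonelli1; last first.
- by move=> z; rewrite lee_fin mulr_ge0.
- apply/measurable_EFinP; apply: measurable_funM.
    exact: (measurableT_comp m1 measurable_fst).
  exact: (measurableT_comp m2 measurable_snd).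
rewrite /fubini_F /=.
have -> : \int[l2]_(x in B) (g2 x)%:E = \int[l2]_x ((g2 \_ B) x)%:E.
  by rewrite integral_mkcond; apply: eq_integral => x _; rewrite /patch; case: ifP.
have -> : \int[l1]_(x in A) (g1 x)%:E = \int[l1]_x ((g1 \_ A) x)%:E.
  by rewrite integral_mkcond; apply: eq_integral => x _; rewrite /patch; case: ifP.
rewrite -ge0_integralZr//; last 3 first.
- exact/measurable_EFinP.
- by move=> x _; rewrite lee_fin.
- by apply: integral_ge0 => x _; rewrite lee_fin.
apply: eq_integral => x _; rewrite -ge0_integralZl//.
- exact/measurable_EFinP.
- by move=> y _; rewrite lee_fin.
- by rewrite lee_fin.
Qed.

End product_density.

(** * Maps that multiply a measure by a constant *)

Section image_measure.
Context d1 d2 (T1 : measurableType d1) (T2 : measurableType d2) (R : realType).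
Variables (m : {measure set T1 -> \bar R}) (phi : T1 -> T2).
Hypothesis mphi : measurable_fun setT phi.

(** The proof of measurability is an argument, so that the canonical structure
    of measure can be inferred. *)
Definition image_measure of measurable_fun setT phi := pushforward m phi.

Local Notation nu := (image_measure mphi).

Let nu0 : nu set0 = 0%E. Proof. exact: measure0. Qed.

Let nu_ge0 A : (0 <= nu A)%E. Proof. exact: measure_ge0. Qed.

Let nu_sigma_additive : semi_sigma_additive nu.
Proof. exact: (@measure_semi_sigma_additive _ _ _ (pushforward m phi)). Qed.

HB.instance Definition _ := isMeasure.Build _ _ _ nu nu0 nu_ge0 nu_sigma_additive.

End image_measure.

Section scaling.
Local Open Scope ereal_scope.

(** The constant c is the absolute value of the Jacobian of phi: this is the
    change of variables formula for indicator functions. *)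
Definition scales d (T : measurableType d) (R : realType)
    (c : R) (m : set T -> \bar R) (phi : T -> T) : Prop :=
  [/\ (0 <= c)%R, measurable_fun setT phi &
      forall A, measurable A -> c%:E * m (phi @^-1` A) = m A].

Lemma preimage_measurable d d' (T : measurableType d) (T' : measurableType d')
    (phi : T -> T') A :
  measurable_fun setT phi -> measurable A -> measurable (phi @^-1` A).
Proof. by move=> mphi mA; rewrite -[X in measurable X]setTI; exact: mphi. Qed.

Lemma ge0_integral_scales d (T : measurableType d) (R : realType)
    (c : R) (m : {measure set T -> \bar R}) (phi : T -> T) (D : set T)
    (g : T -> \bar R) :
  scales c m phi -> measurable D -> measurable_fun D g ->
  (forall x, D x -> 0 <= g x) ->
  \int[m]_(x in D) g x = c%:E * \int[m]_(x in phi @^-1` D) g (phi x).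
Proof.
move=> [c0 mphi cm] mD mg g0.
transitivity (\int[mscale (NngNum c0) (image_measure m mphi)]_(x in D) g x).
  by apply: eq_measure_integral => A mA _; rewrite /= /mscale /image_measure /pushforward /= cm.
rewrite ge0_integral_mscale//; congr (_ * _).
by rewrite (ge0_integral_pushforward mphi)// => x; rewrite inE; exact: g0.
Qed.

(** The pushforward of the product measure, multiplied by the two constants,
    is a measure with the right values on rectangles, and a product measure is
    determined by these values. *)
Lemma scales_prod d1 d2 (T1 : measurableType d1) (T2 : measurableType d2)
    (R : realType) (m1 : {sigma_finite_measure set T1 -> \bar R})
    (m2 : {sigma_finite_measure set T2 -> \bar R}) c1 c2 phi1 phi2 :
  scales c1 m1 phi1 -> scales c2 m2 phi2 ->
  scales (c1 * c2)%R (m1 \x m2) (fun z => (phi1 z.1, phi2 z.2)).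
Proof.
move=> [c10 mphi1 E1] [c20 mphi2 E2].
have mphi : measurable_fun setT (fun z : T1 * T2 => (phi1 z.1, phi2 z.2)).
  apply: measurable_fun_pair.
    exact: (measurableT_comp mphi1 measurable_fst).
  exact: (measurableT_comp mphi2 measurable_snd).
have c0 : (0 <= c1 * c2)%R by rewrite mulr_ge0.
split => // A mA.
rewrite [RHS](@product_measure_unique _ _ _ _ _ m1 m2
  (mscale (NngNum c0) (image_measure (m1 \x m2) mphi)))//.
move=> X Y mX mY /=; rewrite /mscale /image_measure /pushforward /=.
rewrite (_ : _ @^-1` _ = (phi1 @^-1` X) `*` (phi2 @^-1` Y))//.
rewrite product_measure1E; [|exact: preimage_measurable..].
by rewrite -(E1 _ mX) -(E2 _ mY) EFinM muleACA.
Qed.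

Lemma scales_swap d (T : measurableType d) (R : realType)
    (m : {sigma_finite_measure set T -> \bar R}) :
  scales 1%R (m \x m) (fun z => (z.2, z.1)).
Proof.
have ms : measurable_fun setT (fun z : T * T => (z.2, z.1)).
  exact: (measurable_fun_pair measurable_snd measurable_fst).
split => // A mA; rewrite mul1e.
rewrite [RHS](@product_measure_unique _ _ _ _ _ m m (image_measure (m \x m) ms))//.
move=> X Y mX mY /=; rewrite /image_measure /pushforward /=.
rewrite (_ : _ @^-1` _ = Y `*` X); last by apply/seteqP; split => -[x y] [].
by rewrite product_measure1E// muleC.
Qed.

Lemma scales_comp d (T : measurableType d) (R : realType)
    (m : {measure set T -> \bar R}) c1 c2 phi1 phi2 :
  scales c1 m phi1 -> scales c2 m phi2 -> scales (c1 * c2)%R m (phi1 \o phi2).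
Proof.
move=> [c10 mphi1 E1] [c20 mphi2 E2]; split; first by rewrite mulr_ge0.
  exact: measurableT_comp.
move=> A mA; rewrite -(E1 _ mA) -[in RHS]E2; last exact: preimage_measurable.
by rewrite EFinM muleA.
Qed.

End scaling.

(** * Affine changes of variables in R^n *)

Section affine.
Variable R : realType.
Local Notation leb1 := (@lebesgue_measure R).

Lemma scales_opp1 : scales 1 leb1 (-%R : _ -> measurableTypeR R).
Proof.
split=> //.
by move=> A mA; rewrite mul1e -[RHS]lebesgue_measureN.
Qed.

Lemma scales_affine1_pos (a s : R) : 0 < s ->
  scales s leb1 (fun y => a + s * y : measurableTypeR R).
Proof.
move=> s0; have mphi : measurable_fun setT (fun y => a + s * y : measurableTypeR R).
  by apply: measurable_funD => //; exact: measurable_funM.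
split => //; first exact: ltW.
move=> A mA.
rewrite [RHS](@lebesgue_measure_unique _
  (mscale (NngNum (ltW s0)) (image_measure leb1 mphi)))//.
move=> _ [[b c]] _ <-; rewrite /= /mscale /image_measure /pushforward /=.
rewrite (_ : _ @^-1` _ = `](b - a) / s, (c - a) / s]%classic); last first.
  apply/seteqP; split => y; rewrite /= !in_itv /= ltr_pdivrMr// ler_pdivlMr//;
  by rewrite ltrBlDl lerBrDl (mulrC y).
rewrite !lebesgue_measure_itv /= !lte_fin ltr_pM2r ?invr_gt0// ltrD2r.
case: ifPn => bc; last by rewrite mule0.
rewrite -!EFinB -EFinM; congr EFin.
by field; rewrite gt_eqF.
Qed.

Lemma scales_affine1 (a s : R) : s != 0 ->
  scales `|s| leb1 (fun y => a + s * y : measurableTypeR R).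
Proof.
case: (ltgtP s 0) => // s0 _; last by rewrite gtr0_norm//; exact: scales_affine1_pos.
rewrite ltr0_norm//.
have := @scales_comp _ _ _ leb1 _ _ _ _
  (@scales_affine1_pos a (- s) (_ : 0 < - s)) scales_opp1.
rewrite oppr_gt0 mulr1 => /(_ s0); congr (scales _ _ _).
by apply/funext => y /=; rewrite mulrNN.
Qed.

Lemma measurable_affine n (a : 'rV[R]_n) (s : R) :
  measurable_fun setT (fun y : 'rV[R]_n => a + s *: y).
Proof.
apply: measurable_fun_rVP => i.
rewrite (_ : _ \o _ = (fun y => a 0 i + s * @rV_coord R n i y)).
  apply: measurable_funD => //; apply: measurable_funM => //.
  exact: measurable_rV_coord.
by apply/funext => y; rewrite /rV_coord /= !mxE.
Qed.

(** By induction on the dimension: the Lebesgue measure of R^(n+1) is the image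
    of a product, on which the map acts on each factor. *)
Lemma scales_affine n (a : 'rV[R]_n) (s : R) : s != 0 ->
  scales (`|s| ^+ n) (lebesgue_rV R n) (fun y => a + s *: y).
Proof.
move=> s0; elim: n a => [|n IH] a.
  split=> //; first exact: measurable_affine.
  move=> A mA; rewrite expr0 mul1e; congr (_ _); apply/seteqP.
  by split => x /=; rewrite (thinmx0 x) (thinmx0 (_ + _)).
have a0 := @scales_affine1 (lsubmx (a : 'rV_(1 + n)) 0 0) s s0.
have {IH}aL := IH (rsubmx (a : 'rV_(1 + n))).
have [_ _ E] := scales_prod a0 aL.
split; [by rewrite exprn_ge0|exact: measurable_affine|move=> A mA].
have consE (z : measurableTypeR R * 'rV[R]_n) : a + s *: rV_cons z =
    rV_cons (lsubmx (a : 'rV_(1 + n)) 0 0 + s * z.1,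
             rsubmx (a : 'rV_(1 + n)) + s *: z.2).
  apply/rowP => i; rewrite /rV_cons; have [j ->|j ->] := @split_ordP 1 n i.
    by rewrite 2!mxE 2!(@row_mxEl _ _ 1 n) !mxE ord1.
  by rewrite 2!mxE 2!(@row_mxEr _ _ 1 n) !mxE.
have lebS B : lebesgue_rV R n.+1 B =
  (leb1 \x lebesgue_rV R n)%E (@rV_cons R n @^-1` B) by [].
rewrite exprS !lebS -[RHS]E; last first.
  exact: preimage_measurable (@measurable_rV_cons R n) mA.
rewrite (_ : @rV_cons R n @^-1` _ = (fun z => (lsubmx (a : 'rV_(1 + n)) 0 0 + s * z.1,
  rsubmx (a : 'rV_(1 + n)) + s *: z.2)) @^-1` (@rV_cons R n @^-1` A))//.
by apply/seteqP; split => z; rewrite /preimage /= consE.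
Qed.

End affine.

(** * Balls of R^n and the set Z *)

Section balls.
Variables (R : realType) (n : nat).
Local Notation Rn := 'rV[R]_n.
Local Notation leb := (@lebesgue_rV R n).

Lemma rV_ballP (x : Rn) (r : R) (y : Rn) : 0 < r ->
  ball x r y <-> forall i, `|x 0 i - y 0 i| < r.
Proof.
move=> r0; split => [[_ xy] i|xy]; first by have := xy 0 i; rewrite -ball_normE.
by split => // i j; rewrite -ball_normE /= ord1; exact: xy.
Qed.

Lemma measurable_coord i : measurable_fun setT (fun y : Rn => y 0 i).
Proof. exact: (measurable_rV_coord (R := R) i). Qed.

Lemma measurable_open (U : set Rn) : open U -> measurable U.
Proof.
by move=> oU; rewrite measurable_rV_borel; exact: sub_sigma_algebra.
Qed.

Lemma measurable_rV_ball (x : Rn) r : measurable (ball x r).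
Proof. by apply: measurable_open; exact: ball_open. Qed.

Lemma lebesgue_rV_ball (x : Rn) (r : R) : 0 < r ->
  leb (ball x r) = ((r *+ 2) ^+ n)%:E.
Proof.
move=> r0; rewrite (_ : ball x r = [set y | forall i, ball (x 0 i) r (y 0 i)]).
  rewrite (lebesgue_rV_box (A := fun i => ball (x 0 i) r)); last first.
    by move=> i; exact: measurable_ball.
  under eq_bigr do rewrite lebesgue_measure_ball ?ltW//.
  by rewrite prodEFin prodr_const card_ord.
apply/seteqP; split => y /=.
  by move=> /(rV_ballP _ _ r0) xy i; rewrite -ball_normE/=.
by move=> xy; apply/(rV_ballP _ _ r0) => i; have := xy i; rewrite -ball_normE.
Qed.

End balls.

Section lens.
Variables (R : realType) (p : nat).
Local Notation Rp := 'rV[R]_p.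
Local Notation leb := (@lebesgue_rV R p).
Local Notation leb2 := (leb \x leb)%E.
Local Notation Z1 := (Zset 1%:E (0 : Rp)).

Lemma coord_le_eucl (y : Rp) i : `|y 0 i| <= eucl_norm y.
Proof.
rewrite -sqrtr_sqr ler_wsqrtr// expr2 /inner (bigD1 i)//= lerDl.
by apply: sumr_ge0 => j _; rewrite -expr2 sqr_ge0.
Qed.

Lemma eucl_normZ (s : R) (y : Rp) : eucl_norm (s *: y) = `|s| * eucl_norm y.
Proof.
rewrite -sqrtr_sqr -sqrtrM ?sqr_ge0//; congr Num.sqrt.
rewrite /inner mulr_sumr; apply: eq_bigr => i _; rewrite !mxE; ring.
Qed.

Lemma eucl_normN (y : Rp) : eucl_norm (- y) = eucl_norm y.
Proof. by rewrite -scaleN1r eucl_normZ normrN1 mul1r. Qed.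

Lemma measurable_eucl_norm d (T : measurableType d) (g : T -> Rp) :
  measurable_fun setT g -> measurable_fun setT (fun t => eucl_norm (g t)).
Proof.
move=> mg.
have msqrt : measurable_fun [set: R] (@Num.sqrt R).
  by apply: continuous_measurable_fun; exact: sqrt_continuous.
apply: (measurableT_comp msqrt); apply: measurable_sum => i.
by apply: measurable_funM; exact: (measurableT_comp (measurable_coord i) mg).
Qed.

Lemma measurable_rVB d (T : measurableType d) (g h : T -> Rp) :
  measurable_fun setT g -> measurable_fun setT h ->
  measurable_fun setT (fun t => g t - h t).
Proof.
move=> mg mh; apply: measurable_fun_rVP => i.
rewrite (_ : _ \o _ = fun t => g t 0 i - h t 0 i); last first.
  by apply/funext => t /=; rewrite /rV_coord !mxE.
by apply: measurable_funB; exact: (measurableT_comp (measurable_coord i)).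
Qed.

Lemma measurable_Zset (tau : R) (x : Rp) : measurable (Zset tau%:E x).
Proof.
have m1 : measurable_fun setT (fun z : Rp * Rp => eucl_norm (x - z.1)).
  by apply: measurable_eucl_norm; exact: measurable_rVB.
have m2 : measurable_fun setT (fun z : Rp * Rp => eucl_norm (x - z.2)).
  by apply: measurable_eucl_norm; exact: measurable_rVB.
have m3 : measurable_fun setT (fun z : Rp * Rp => eucl_norm (z.1 - z.2)).
  by apply: measurable_eucl_norm; exact: measurable_rVB.
have mle (T : measurableType _) (g h : T -> R) : measurable_fun setT g ->
    measurable_fun setT h -> measurable [set t | g t <= h t].
  move=> mg mh; have := measurable_fun_ler mg mh measurableT
    (Logic.I : measurable [set true]).
  by rewrite setTI.
rewrite (_ : Zset _ _ =
    [set z | Num.max (eucl_norm (x - z.1)) (eucl_norm (x - z.2))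
              <= eucl_norm (z.1 - z.2)] `&`
    [set z | eucl_norm (z.1 - z.2) <= tau]).
  by apply: measurableI; apply: mle => //; exact: measurable_maxr.
by apply/seteqP; split => z; rewrite /Zset /= lee_fin.
Qed.

(** The ball of radius 2 is a convenient open neighbourhood of the closed
    unit ball. *)
Lemma Z1_sub : Z1 `<=` ball (0 : Rp) 2 `*` ball (0 : Rp) 2.
Proof.
move=> z; rewrite /Zset /= ge_max lee_fin => -[/andP[h1 h2] z12].
have H (y : Rp) : eucl_norm (0 - y) <= 1 -> ball (0 : Rp) 2 y.
  move=> y1; apply/rV_ballP => // i.
  have := coord_le_eucl (0 - y) i; rewrite !mxE => /le_lt_trans; apply.
  by apply: (le_lt_trans y1); rewrite ltr1n.
by split; apply: H; [exact: le_trans h1 z12|exact: le_trans h2 z12].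
Qed.

(** The set Z_tau(x) is Z_1(0) dilated by tau and translated by x, since the
    inequalities that define it only involve differences and are homogeneous. *)
Lemma Zset_affine (x : Rp) (tau : R) : 0 < tau ->
  (fun z => (x + tau *: z.1, x + tau *: z.2)) @^-1` Zset tau%:E x = Z1.
Proof.
move=> t0; apply/seteqP; split => -[y1 y2]; rewrite /preimage /Zset /=;
  rewrite !lee_fin !sub0r !opprD !addNKr addrACA subrr add0r -!scalerN -scalerDr;
  rewrite !eucl_normZ gtr0_norm// -maxr_pMr ?(ltW t0)// ler_pM2l// ger_pMr//.
Qed.

Lemma measurable_Z1 : measurable Z1.
Proof. exact: measurable_Zset. Qed.

Lemma leb2_Z1_lty : (leb2 Z1 < +oo)%E.
Proof.
apply: (@le_lt_trans _ _ (leb2 (ball (0 : Rp) 2 `*` ball (0 : Rp) 2))).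
  apply: le_measure; rewrite ?inE; [exact: measurable_Z1| |exact: Z1_sub].
  by apply: measurableX; exact: measurable_rV_ball.
rewrite product_measure1E; [|exact: measurable_rV_ball..].
have fin : (leb (ball (0%R : Rp) 2%R) < +oo)%E by rewrite lebesgue_rV_ball// ltry.
by rewrite lte_mul_pinfty// ge0_fin_numE.
Qed.

(** Z_1(0) contains a product of two boxes in opposite orthants, where the
    inequalities hold coordinate by coordinate. *)
Lemma Lambda1_gt0 : 0 < Lambda1 R p.
Proof.
rewrite /Lambda1 fine_gt0// leb2_Z1_lty andbT.
(* the coordinates of z.1 - z.2 are below 4 a, and p (4 a)^2 <= 1 *)
pose a : R := (4 * p.+1%:R)^-1.
have a0 : 0 < a by rewrite invr_gt0 mulr_gt0// ltr0n.
pose A := [set y : Rp | forall i : 'I_p, y 0 i \in `]a, (2 * a)[].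
pose B := [set y : Rp | forall i : 'I_p, y 0 i \in `](- (2 * a)), (- a)[].
have mbox (I : interval R) : measurable [set y : Rp | forall i : 'I_p, y 0 i \in I].
  rewrite (_ : [set y | _] = \bigcap_(i in [set: 'I_p]) (@rV_coord R p i @^-1` [set` I])).
    apply: fin_bigcap_measurable => // i _.
    by apply: preimage_measurable => //; exact: measurable_rV_coord.
  by apply/seteqP; split => y /= Hy i; [move=> _; exact: Hy|exact: Hy i Logic.I].
have bE (I : interval R) : leb [set y : Rp | forall i : 'I_p, y 0 i \in I] =
    (\prod_(i < p) lebesgue_measure [set` I])%E.
  exact: (lebesgue_rV_box (A := fun=> [set` I])).
have sAB : A `*` B `<=` Z1.
  move=> [y z] [/= Ay Bz]; split => /=.
    rewrite ge_max; apply/andP; split; apply: ler_wsqrtr; apply: ler_sum => i _;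
    rewrite !mxE; have := Ay i; have := Bz i; rewrite !in_itv /= => /andP[? ?] /andP[? ?];
    nra.
  rewrite lee_fin -[leRHS]sqrtr1; apply: ler_wsqrtr.
  have p0 : 0 < (p.+1%:R : R) by rewrite ltr0n.
  have : \sum_(i < p) (y - z) 0 i * (y - z) 0 i <= \sum_(i < p) (p.+1%:R^-1 : R).
    apply: ler_sum => i _.
    have := Ay i; have := Bz i; rewrite !in_itv /= => /andP[? ?] /andP[? ?].
    have ap : a * p.+1%:R = 4^-1 by rewrite /a; field; rewrite gt_eqF.
    have p1 : 1 <= (p.+1%:R : R) by rewrite ler1n.
    have pV : p.+1%:R^-1 = 4 * a :> R by rewrite /a; field; rewrite gt_eqF.
    have a4 : a <= 4^-1 by nra.
    rewrite pV !mxE; nra.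
  move=> /le_trans; apply; rewrite sumr_const card_ord -[_ *+ p]mulr_natr mulrC.
  by rewrite ler_pdivrMr// mul1r ler_nat.
have mAB : measurable (A `*` B) by apply: measurableX; exact: mbox.
have := le_measure leb2 (mem_set mAB) (mem_set measurable_Z1) sAB.
apply: lt_le_trans.
rewrite [ltRHS](_ : _ = (leb A * leb B)%E); last first.
  by apply: product_measure1E; exact: mbox.
rewrite !bE !lebesgue_measure_itv/= !lte_fin.
have -> : a < 2 * a by lra.
have -> : - (2 * a) < - a by lra.
rewrite -!EFinB !prodEFin -EFinM lte_fin mulr_gt0// prodr_gt0// => i _; lra.
Qed.

End lens.

Section rescaling.
Variables (R : realType) (p : nat) (P : probability 'rV[R]_p R).
Variables (f : 'rV[R]_p -> R) (hf : is_density P f).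
Local Notation Rp := 'rV[R]_p.
Local Notation leb := (@lebesgue_rV R p).
Local Notation leb2 := (leb \x leb)%E.
Local Notation Z1 := (Zset 1%:E (0 : Rp)).

Lemma density_integral_lty : (\int[leb]_x (f x)%:E < +oo)%E.
Proof. by have [_ _ <-//] := hf; rewrite probability_setT ltry. Qed.

(** Both sides are measures in A that agree on rectangles. *)
Lemma product_density_measure (A : set (Rp * Rp)) : measurable A ->
  (P \x P)%E A = (\int[leb2]_(z in A) (f z.1 * f z.2)%:E)%E.
Proof.
have [mf f0 Pf] := hf; move=> mA.
have mff : measurable_fun setT (fun z : Rp * Rp => f z.1 * f z.2).
  by apply: measurable_funM; exact: measurableT_comp.
have ff0 (z : Rp * Rp) : 0 <= f z.1 * f z.2 by rewrite mulr_ge0.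
rewrite (@product_measure_unique _ _ _ _ _ P P (density_measure leb2 mff ff0))//.
by move=> X Y mX mY; rewrite /= /density_measure integral_tensor//; congr (_ * _)%E; exact/esym/Pf.
Qed.

Variables (x : Rp) (tau : R) (tau0 : 0 < tau).

Let ff (z : Rp * Rp) := f (x + tau *: z.1) * f (x + tau *: z.2).

Lemma measurable_rescaled : measurable_fun setT (fun y : Rp => f (x + tau *: y)).
Proof. by have [mf _ _] := hf; apply: measurableT_comp => //; exact: measurable_affine. Qed.

Lemma measurable_rescaled2 : measurable_fun setT ff.
Proof.
apply: measurable_funM.
  exact: (measurableT_comp measurable_rescaled measurable_fst).
exact: (measurableT_comp measurable_rescaled measurable_snd).
Qed.

Lemma product_measure_Zset :
  ((P \x P) (Zset tau%:E x) = (tau ^+ (2 * p))%:E * \int[leb2]_(z in Z1) (ff z)%:E)%E.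
Proof.
have [mf f0 Pf] := hf.
have t0 : tau != 0 by rewrite gt_eqF.
have S := scales_prod (scales_affine x t0) (scales_affine x t0).
rewrite product_density_measure; last exact: measurable_Zset.
rewrite (ge0_integral_scales S); last 3 first.
- exact: measurable_Zset.
- apply/measurable_EFinP/measurable_funTS.
  by apply: measurable_funM; exact: measurableT_comp.
- by move=> z _; rewrite lee_fin mulr_ge0.
by rewrite Zset_affine// gtr0_norm// -exprD addnn -mul2n.
Qed.

Lemma integrable_rescaled : leb2.-integrable Z1 (EFin \o ff).
Proof.
have [mf f0 Pf] := hf.
apply/integrableP; split.
  by apply/measurable_EFinP; apply: measurable_funTS; exact: measurable_rescaled2.
rewrite (eq_integral (fun z => (ff z)%:E)); last first.
  by move=> z _ /=; rewrite ger0_norm// mulr_ge0.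
have : ((P \x P) (Zset tau%:E x) < +oo)%E.
  apply: (@le_lt_trans _ _ ((P \x P) setT)%E).
    by apply: le_measure; rewrite ?inE//; exact: measurable_Zset.
  rewrite -setXTT product_measure1E// (_ : (_ * _)%E = 1%E) ?ltry//.
  by rewrite -[RHS]mule1; congr (_ * _)%E; exact: probability_setT.
rewrite product_measure_Zset.
set I := (\int[_]_(_ in _) _)%E.
have : (0 <= I)%E by apply: integral_ge0 => z _; rewrite lee_fin mulr_ge0.
case: I => [r _ _| |//]; first by rewrite ltry.
by move=> _; rewrite mulry gtr0_sg ?mul1e// exprn_gt0.
Qed.

(** After this change of variables the domain of integration is fixed, and the
    limits concern the integrand only. *)
Lemma LLD_rescaled : (tau ^+ (2 * p))^-1 * LLD P x tau%:E =
  \int[leb2]_(z in Z1) (f (x + tau *: z.1) * f (x + tau *: z.2)).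
Proof.
have -> : LLD P x tau%:E = fine ((P \x P)%E (Zset tau%:E x)).
  by rewrite /LLD /Rintegral integral_indic ?setIT//; exact: measurable_Zset.
rewrite product_measure_Zset fineM//; last first.
  by apply: integrable_fin_num; [exact: measurable_Z1|exact: integrable_rescaled].
by rewrite mulrA mulVf ?mul1r// expf_neq0// gt_eqF.
Qed.

End rescaling.

(** * Outer regularity of finite Borel measures *)

Lemma exists_natSinv_lt (R : realType) (e : R) : 0 < e ->
  exists k, k.+1%:R^-1 < e.
Proof.
move=> e0; have [k _ /(_ k (leqnn k)) ke] := near_infty_natSinv_lt (PosNum e0).
by exists k.
Qed.

Section outer_regularity.
Variables (R : realType) (n : nat).
Local Notation Rn := 'rV[R]_n.
Variable nu : {measure set Rn -> \bar R}.
Hypothesis nufin : (nu setT < +oo)%E.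

Definition outer_regular (A : set Rn) := forall e : R, 0 < e ->
  exists U, [/\ open U, A `<=` U & (nu (U `\` A) <= e%:E)%E].

Let nu_lty A : measurable A -> (nu A < +oo)%E.
Proof. by move=> mA; apply: le_lt_trans nufin; rewrite le_measure ?inE. Qed.

Lemma open_outer_regular (A : set Rn) : open A -> outer_regular A.
Proof.
by move=> oA e e0; exists A; split => //; rewrite setDv measure0 lee_fin ltW.
Qed.

(** By continuity from above, which relies on the finiteness of the measure. *)
Lemma nonincreasing_outer_regular (V : (set Rn)^nat) :
  (forall k, open (V k)) -> (forall k, V k.+1 `<=` V k) ->
  outer_regular (\bigcap_k V k).
Proof.
move=> oV decV e e0.
have mV k : measurable (V k) by exact: measurable_open.
have mW : measurable (\bigcap_k V k) by exact: bigcap_measurable.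
pose F k := V k `\` \bigcap_k V k.
have mF k : measurable (F k) by exact: measurableD.
have F0 : \bigcap_k F k = set0.
  rewrite -subset0 => x Fx.
  have [_] := Fx 0 Logic.I; apply => k _.
  by have [] := Fx k Logic.I.
have decF : {homo F : n m / (n <= m)%N >-> (m <= n)%O}.
  apply/nonincreasing_seqP => k; apply/subsetPset => x [Vx nW]; split => //.
  exact: decV.
have := @nonincreasing_cvg_mu _ _ _ nu F (nu_lty (mF 0)) mF.
rewrite F0 measure0 => /(_ measurable0 decF).
move=> /(_ [set x | (x < e%:E)%E]) [].
  by apply: open_nbhs_nbhs; split; [exact: open_ereal_lt_ereal|rewrite /= lte_fin].
move=> k _ /(_ k (leqnn k)) /= /ltW nuk.
by exists (V k); split => // x Wx; exact: Wx.
Qed.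

(** A closed set is the intersection of its open neighbourhoods of radius
    1 / (k + 1). *)
Lemma closed_outer_regular (A : set Rn) : closed A -> outer_regular A.
Proof.
move=> cA.
pose V k := \bigcup_(y in A) ball y (k.+1%:R^-1 : R).
have -> : A = \bigcap_k V k.
  apply/seteqP; split => x.
    by move=> Ax k _; exists x => //; apply: ballxx; rewrite invr_gt0 ltr0n.
  move=> Vx; apply: contrapT => nAx.
  have oA : open (~` A) by rewrite openC.
  have /nbhs_ballP[e /= e0 eA] : nbhs x (~` A) by exact: open_nbhs_nbhs.
  have [k ke] := exists_natSinv_lt e0.
  have [y Ay yx] := Vx k Logic.I.
  by apply: (eA y _ Ay); apply/ball_sym; apply: le_ball yx; exact: ltW.
apply: nonincreasing_outer_regular => k.
  by apply: bigcup_open => y _; exact: ball_open.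
apply: subset_bigcup => y _; apply: le_ball.
by rewrite lef_pV2 ?posrE ?ltr0n// ler_nat.
Qed.

Let geometric_bound (D : set Rn) (F : (set Rn)^nat) (e : R) : 0 < e ->
  measurable D -> (forall k, measurable (F k)) -> D `<=` \bigcup_k F k ->
  (forall k, (nu (F k) <= (e / (2 ^ k.+1)%:R)%:E)%E) -> (nu D <= e%:E)%E.
Proof.
move=> e0 mD mF DF Fe.
apply: (le_trans (measure_sigma_subadditive nu mF mD DF)).
(* the weights e / 2^(k+1) have sum e *)
apply: (@le_trans _ _ (\sum_(0 <= k <oo) (0 + (e / (2 ^ k.+1)%:R)%:E))%E).
  by apply: lee_nneseries => // k _; rewrite add0e; exact: Fe.
apply: (le_trans (epsilon_trick _ _ (ltW e0))) => //.
by rewrite eseries0// add0e.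
Qed.

Lemma bigcup_outer_regular (A : (set Rn)^nat) : (forall k, measurable (A k)) ->
  (forall k, outer_regular (A k)) -> outer_regular (\bigcup_k A k).
Proof.
move=> mA rA e e0.
have /choice[U UP] : forall k, exists U, [/\ open U, A k `<=` U &
    (nu (U `\` A k) <= (e / (2 ^ k.+1)%:R)%:E)%E].
  by move=> k; apply: rA; rewrite divr_gt0// ltr0n expn_gt0.
have oU k : open (U k) by have [] := UP k.
have mU k : measurable (U k) by exact: measurable_open.
exists (\bigcup_k U k); split.
- exact: bigcup_open.
- by apply: subset_bigcup => k _; have [] := UP k.
apply: (@geometric_bound _ (fun k => U k `\` A k)) => //.
- by apply: measurableD; exact: bigcup_measurable.
- by move=> k; exact: measurableD.
- by move=> x [[k _ Ukx] nA]; exists k => //; split => // Akx; apply: nA; exists k.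
- by move=> k; have [] := UP k.
Qed.

(** Enclosing each set only gives a countable intersection of open sets, whose
    finite subintersections are open and close to it in measure. *)
Lemma bigcap_outer_regular (A : (set Rn)^nat) : (forall k, measurable (A k)) ->
  (forall k, outer_regular (A k)) -> outer_regular (\bigcap_k A k).
Proof.
move=> mA rA e e0.
have e20 : 0 < e / 2 by rewrite divr_gt0.
have /choice[U UP] : forall k, exists U, [/\ open U, A k `<=` U &
    (nu (U `\` A k) <= (e / 2 / (2 ^ k.+1)%:R)%:E)%E].
  by move=> k; apply: rA; rewrite divr_gt0// ltr0n expn_gt0.
have oU k : open (U k) by have [] := UP k.
have mU k : measurable (U k) by exact: measurable_open.
pose V k := \big[setI/setT]_(i < k) U i.
have oV k : open (V k).
  by apply: (big_ind open); [exact: openT|exact: openI|].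
have VU : \bigcap_k V k = \bigcap_k U k.
  apply/seteqP; split => x.
    by move=> Vx k _; have := Vx k.+1 Logic.I; rewrite /V big_ord_recr /= => -[].
  move=> Ux k _; apply: (big_ind (fun S : set Rn => S x)) => //.
  by move=> i _; exact: Ux.
have mIA : measurable (\bigcap_k A k) by exact: bigcap_measurable.
have mIU : measurable (\bigcap_k U k) by exact: bigcap_measurable.
have [|W [oW VW We]] := @nonincreasing_outer_regular V oV _ (e / 2) e20.
  by move=> k x; rewrite /V big_ord_recr /= => -[].
have mW : measurable W by exact: measurable_open.
exists W; split => //.
  apply: subset_trans VW; rewrite VU; apply: subset_bigcap => k _.
  by have [] := UP k.
rewrite (splitr e) EFinD; apply: (@le_trans _ _
  (nu ((W `\` \bigcap_k V k) `|` (\bigcap_k U k `\` \bigcap_k A k)))).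
  rewrite le_measure ?inE//; first exact: measurableD.
    by apply: measurableU; apply: measurableD => //; rewrite VU.
  move=> x [Wx nA]; have [Vx|nVx] := pselect ((\bigcap_k V k) x); [right|left] => //.
  by split => //; rewrite -VU.
apply: (le_trans (measureU2 nu _ _)).
- by apply: measurableD => //; rewrite VU.
- exact: measurableD.
apply: leeD => //; apply: (@geometric_bound _ (fun k => U k `\` A k)) => //.
- exact: measurableD.
- by move=> k; exact: measurableD.
- move=> x [Ux /existsNP[k /not_implyP[_ nAx]]].
  by exists k => //; split => //; exact: Ux.
- by move=> k; have [] := UP k.
Qed.

(** The sets that are outer regular together with their complement form a
    sigma-algebra that contains the open sets. *)
Lemma measurable_outer_regular (A : set Rn) : measurable A -> outer_regular A.
Proof.
move=> mA.
pose G := [set A : set Rn | [/\ measurable A, outer_regular A & outer_regular (~` A)]].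
suff : G A by case.
move: A mA; rewrite measurable_rV_borel; apply: smallest_sub.
  split.
  - split => //; first by apply: open_outer_regular; exact: open0.
    by rewrite setC0; apply: open_outer_regular; exact: openT.
  - by move=> A [mA rA rCA]; rewrite setTD; split; rewrite ?setCK//; exact: measurableC.
  - move=> A GA; split.
    + by apply: bigcup_measurable => k _; have [] := GA k.
    + by apply: bigcup_outer_regular => k; have [] := GA k.
    + rewrite setC_bigcup; apply: bigcap_outer_regular => k; have [] := GA k => //.
      by move=> mA _ _; exact: measurableC.
move=> U oU; split; [exact: measurable_open|exact: open_outer_regular|].
by apply: closed_outer_regular; rewrite closedC.
Qed.

End outer_regularity.

(** * Lebesgue points *)

Section covering.
Variables (R : realType) (n : nat).
Local Notation Rn := 'rV[R]_n.
Local Notation leb := (@lebesgue_rV R n).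

Definition union_balls (s : seq (Rn * R)) : set Rn :=
  \bigcup_(b in [set` s]) ball b.1 b.2.

Lemma measurable_union_balls s : measurable (union_balls s).
Proof.
by apply: measurable_open; apply: bigcup_open => b _; exact: ball_open.
Qed.

Lemma exists_largest_ball (s : seq (Rn * R)) : s != [::] ->
  exists2 b, b \in s & forall b', b' \in s -> b'.2 <= b.2.
Proof.
elim: s => // a [_ _|c s /(_ isT)[b bs bmax] _].
  by exists a => [|b']; rewrite ?mem_head// inE => /eqP ->.
have [ab|ba] := leP a.2 b.2.
  by exists b => [|b']; rewrite in_cons ?bs ?orbT// => /predU1P[->//|/bmax].
exists a => [|b']; first exact: mem_head.
by rewrite in_cons => /predU1P[->//|/bmax /le_trans]; apply; exact: ltW.
Qed.

(** Vitali's argument: the balls that meet the largest one lie in its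
    threefold dilation, the others are dealt with by induction. *)
Lemma vitali_measure_bound (nu : {measure set Rn -> \bar R}) (C : R)
    (s : seq (Rn * R)) : 0 <= C ->
  (forall b, b \in s -> 0 < b.2 /\ (leb (ball b.1 b.2) <= C%:E * nu (ball b.1 b.2))%E) ->
  (leb (union_balls s) <= (3 ^+ n * C)%:E * nu (union_balls s))%E.
Proof.
move=> C0; have [k] := ubnP (size s); elim: k s => // k IH s sk Hs.
have [->|s0] := eqVneq s [::].
  rewrite (_ : union_balls _ = set0) ?measure0 ?mule0//.
  by rewrite -subset0 => x [].
have [[c r] bs rmax] := exists_largest_ball s0.
have [/= r0 cr] := Hs _ bs.
pose t := [seq b <- s | `[< ball b.1 b.2 `&` ball c r = set0 >]].
have ts : {subset t <= s} by move=> b; rewrite mem_filter => /andP[].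
have sub3 : union_balls s `<=` ball c (r *+ 3) `|` union_balls t.
  move=> y [b /= sb by_].
  have [d0|/set0P[z [bz cz]]] := eqVneq (ball b.1 b.2 `&` ball c r) set0.
    by right; exists b => //=; rewrite mem_filter sb andbT; apply/asboolP.
  left; have br := rmax _ sb.
  apply: (@le_ball _ _ c (r + (b.2 + b.2)) (r *+ 3)); first by simpl in *; lra.
  exact: ball_triangle cz (ball_triangle (ball_sym bz) by_).
have sz_t : (size t < k)%N.
  rewrite -ltnS; apply: leq_trans sk; rewrite ltnS size_filter.
  rewrite ltn_neqAle count_size andbT -all_count; apply/allPn; exists (c, r) => //=.
  apply/asboolP => /seteqP[/(_ c) + _]; apply.
  by split; exact: ballxx.
have {IH} Ht := IH t sz_t (fun b bt => Hs b (ts b bt)).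
have mB : measurable (ball c r) by exact: measurable_rV_ball.
have mt := measurable_union_balls t.
have E3 : leb (ball c (r *+ 3)) = ((3 ^+ n)%:E * leb (ball c r))%E.
  rewrite !lebesgue_rV_ball ?pmulrn_lgt0// -EFinM -exprMn; congr EFin.
  by congr (_ ^+ _); ring.
apply: (@le_trans _ _ (leb (ball c (r *+ 3) `|` union_balls t))).
  by rewrite le_measure ?inE//; [exact: measurable_union_balls|
    apply: measurableU => //; exact: measurable_rV_ball].
apply: (@le_trans _ _ (leb (ball c (r *+ 3)) + leb (union_balls t))%E).
  by apply: measureU2 => //; exact: measurable_rV_ball.
rewrite E3; apply: (@le_trans _ _ ((3 ^+ n * C)%:E * nu (ball c r) +
    (3 ^+ n * C)%:E * nu (union_balls t))%E).
  apply: leeD => //; by rewrite EFinM -muleA lee_wpmul2l// lee_fin exprn_ge0.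
have C3 : (0 <= (3 ^+ n * C)%:E)%E by rewrite lee_fin mulr_ge0// exprn_ge0.
rewrite -ge0_muleDr// lee_wpmul2l//.
rewrite -measureU//; last first.
  rewrite -subset0 => y [cy [b /= + by_]].
  rewrite mem_filter => /andP[/asboolP + _]; rewrite -subset0; apply.
  by split; [exact: by_|].
rewrite le_measure ?inE//; first exact: measurableU.
  exact: measurable_union_balls.
move=> y [cy|[b /= bt by_]]; first by exists (c, r).
by exists b => //=; exact: ts.
Qed.

(** Rational balls form a countable family, and each ball is comparable to one
    of them. *)
Definition rat_ball (b : 'rV[rat]_n * rat) : Rn * R := (map_mx ratr b.1, ratr b.2).

Lemma exists_rat_ball (x : Rn) (r : R) : 0 < r -> exists b,
  [/\ r < (rat_ball b).2 <= r *+ 2,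
      ball x r `<=` ball (rat_ball b).1 (rat_ball b).2 &
      ball (rat_ball b).1 (rat_ball b).2 `<=` ball x (r *+ 3)].
Proof.
move=> r0.
have r2 : 0 < r / 2 by rewrite divr_gt0.
have /choice[q qx] : forall i : 'I_n, exists q : rat, `|x 0 i - ratr q| < r / 2.
  move=> i; have [|q] := @rat_in_itvoo R (x 0 i - r / 2) (x 0 i + r / 2).
    by rewrite ltrD2l gtrN.
  by rewrite in_itv/= => qi; exists q; rewrite ltr_distlC.
have [|s] := @rat_in_itvoo R (r + r / 2) (r *+ 2); first by lra.
rewrite in_itv /= => /andP[s1 s2].
exists (\row_i q i, s); rewrite /rat_ball /=.
have xq : ball x (r / 2) (map_mx ratr (\row_i q i) : Rn).
  by apply/rV_ballP => // i; rewrite !mxE.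
split; first by apply/andP; split; lra.
- move=> y xy; apply: (@le_ball _ _ _ (r / 2 + r)); first by lra.
  exact: ball_triangle (ball_sym xq) xy.
- move=> y qy; apply: (@le_ball _ _ _ (r / 2 + ratr s)); first by lra.
  exact: ball_triangle xq qy.
Qed.

(** All points where the upper density limsup nu(B(x, r)) / r^n exceeds e are in
    this set. *)
Definition not_small (nu : set Rn -> \bar R) (e : R) : set Rn :=
  [set x | forall d, 0 < d -> exists r, 0 < r < d /\
                              ((e * r ^+ n)%:E < nu (ball x r))%E].

(** Restricting to rational balls makes the covering countable, so that its
    union is measurable whatever the covered set is. *)
Lemma not_small_cover (nu : {measure set Rn -> \bar R}) (e : R) (U : set Rn) :
  0 < e -> open U -> exists V,
  [/\ measurable V, not_small nu e `&` U `<=` V &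
      (leb V <= (3 ^+ n * (4 ^+ n / e))%:E * nu U)%E].
Proof.
move=> e0 oU.
(* a ball of radius at most 2 r has Lebesgue measure at most (4 r)^n *)
set C := 4 ^+ n / e.
have C0 : 0 <= C by rewrite divr_ge0 ?exprn_ge0 ?(ltW e0).
pose good b := let b := rat_ball b in [/\ 0 < b.2, ball b.1 b.2 `<=` U &
  (leb (ball b.1 b.2) <= C%:E * nu (ball b.1 b.2))%E].
pose s k := [seq rat_ball b | b <- pmap unpickle (iota 0 k) & `[< good b >]].
pose V k := union_balls (s k).
have VU k : V k `<=` U.
  move=> y [_ /= /mapP[b + ->] by_]; rewrite mem_filter => /andP[/asboolP[_ bU _] _].
  exact: bU.
have mV k : measurable (V k) by exact: measurable_union_balls.
have mU : measurable U by exact: measurable_open.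
have Vle k : (leb (V k) <= (3 ^+ n * C)%:E * nu U)%E.
  apply: (@le_trans _ _ ((3 ^+ n * C)%:E * nu (V k))%E).
    apply: vitali_measure_bound => // _ /mapP[b + ->].
    by rewrite mem_filter => /andP[/asboolP[]].
  apply: lee_wpmul2l; first by rewrite lee_fin mulr_ge0// exprn_ge0.
  by rewrite le_measure ?inE.
have mW : measurable (\bigcup_k V k) by exact: bigcup_measurable.
exists (\bigcup_k V k); split => //.
  move=> x [xbad Ux].
  have /nbhs_ballP[d /= d0 dU] : nbhs x U by exact: open_nbhs_nbhs.
  have [|r [/andP[r0 rd] xr]] := xbad (d / 3); first by rewrite divr_gt0.
  have [b [/andP[rb br] xb bx]] := exists_rat_ball x r0.
  have gb : good b.
    split; first exact: lt_trans rb.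
      by apply: subset_trans bx _; apply: subset_trans dU; apply: le_ball; lra.
    rewrite lebesgue_rV_ball; last exact: lt_trans rb.
    apply: (@le_trans _ _ (C%:E * (e * r ^+ n)%:E)%E).
      rewrite -EFinM lee_fin (_ : C * _ = (r *+ 4) ^+ n); last first.
        rewrite -(mulr_natr r 4) exprMn /C; field; by rewrite gt_eqF.
      have s0 := lt_trans r0 rb.
      by apply: lerXn2r; rewrite ?nnegrE; lra.
    rewrite lee_wpmul2l ?lee_fin//.
    apply: (le_trans (ltW xr)); rewrite le_measure ?inE//; exact: measurable_rV_ball.
  exists (pickle b).+1 => //; exists (rat_ball b) => /=; last first.
    by apply: xb; exact: ballxx.
  apply: map_f; rewrite mem_filter; apply/andP; split; first exact/asboolP.
  rewrite mem_pmap; apply/mapP; exists (pickle b); last by rewrite pickleK.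
  by rewrite mem_iota /= add0n.
have ndV : {homo V : n m / (n <= m)%N >-> (n <= m)%O}.
  move=> k m km; apply/subsetPset => y [_ /= /mapP[b + ->] by_].
  rewrite mem_filter => /andP[gb]; rewrite mem_pmap => /mapP[j + bj].
  rewrite mem_iota add0n => /= jk.
  exists (rat_ball b) => //=; apply: map_f; rewrite mem_filter gb /=.
  rewrite mem_pmap; apply/mapP; exists j => //.
  by rewrite mem_iota add0n /=; exact: leq_trans jk km.
have cV := @nondecreasing_cvg_mu _ _ _ leb V mV mW ndV.
rewrite -(cvg_lim _ cV)//; apply: lime_le; first by apply/cvg_ex; exists (leb (\bigcup_k V k)).
by apply: nearW => k; exact: Vle.
Qed.

(** Outer regularity encloses A in open sets of arbitrarily small measure for
    nu; by the covering bound, the exceptional set then has arbitrarily small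
    Lebesgue measure. *)
Lemma null_set_density0 (nu : {measure set Rn -> \bar R}) (A : set Rn) (e : R) :
  (nu setT < +oo)%E -> measurable A -> nu A = 0%E -> 0 < e ->
  leb.-negligible (not_small nu e `&` A).
Proof.
move=> nufin mA nuA e0.
pose K := 3 ^+ n * (4 ^+ n / e).
have K0 : 0 < K by rewrite mulr_gt0 ?divr_gt0 ?exprn_gt0.
have /choice[V VP] : forall k, exists V, [/\ measurable V,
    not_small nu e `&` A `<=` V & (leb V <= (K * k.+1%:R^-1)%:E)%E].
  move=> k; have k0 : (0 : R) < k.+1%:R^-1 by rewrite invr_gt0 ltr0n.
  have [U [oU AU UA]] := measurable_outer_regular nufin mA k0.
  have [V [mV nsV Vle]] := not_small_cover nu e0 oU.
  exists V; split => //.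
    by apply: subset_trans nsV; apply: setIS.
  apply: (le_trans Vle); rewrite [leRHS]EFinM; apply: lee_wpmul2l; first by rewrite lee_fin ltW.
  have mU : measurable U by exact: measurable_open.
  apply: (@le_trans _ _ (nu A + nu (U `\` A))%E); last by rewrite nuA add0e.
  by rewrite -[X in (nu X <= _)%E](setDUK AU); apply: measureU2 => //; exact: measurableD.
have mV k : measurable (V k) by have [] := VP k.
have mW : measurable (\bigcap_k V k) by exact: bigcap_measurable.
exists (\bigcap_k V k); split => //; last by move=> x Ax k _; have [_ + _] := VP k; apply.
apply/eqP; rewrite -measure_le0; apply/lee_addgt0Pr => r r0; rewrite add0e.
have [k kr] := exists_natSinv_lt (divr_gt0 r0 K0).
have [_ _ Vk] := VP k.
apply: (le_trans _ (le_trans Vk _)).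
  by rewrite le_measure ?inE// => x; apply.
by rewrite lee_fin mulrC -ler_pdivlMr// ltW.
Qed.

End covering.

Section lebesgue_points.
Variables (R : realType) (n : nat).
Local Notation Rn := 'rV[R]_n.
Local Notation leb := (@lebesgue_rV R n).

(** The mean of |f - f(x)| over B(x, r) tends to 0; the volume of the ball is
    replaced by r^n, to which it is proportional. *)
Definition lebesgue_point (f : Rn -> R) (x : Rn) := forall e, 0 < e ->
  exists2 d, 0 < d & forall r, 0 < r < d ->
    (\int[leb]_(y in ball x r) `|f y - f x|%:E <= (e * r ^+ n)%:E)%E.

Lemma continuous_lebesgue_point (f : Rn -> R) (x : Rn) :
  measurable_fun setT f -> {for x, continuous f} -> lebesgue_point f x.
Proof.
move=> mf fc e e0; pose e' := e / 2 ^+ n.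
have e'0 : 0 < e' by rewrite divr_gt0// exprn_gt0.
have /nbhs_ballP[d /= d0 dP] : \forall y \near x, `|f y - f x| <= e'.
  by have /cvgrPdist_le/(_ e' e'0) := fc; apply: filterS => y; rewrite distrC.
exists d => // r /andP[r0 rd].
apply: (@le_trans _ _ (\int[leb]_(y in ball x r) e'%:E)%E).
  apply: ge0_le_integral => //.
  - exact: measurable_rV_ball.
  - apply/measurable_EFinP; apply: measurable_funTS.
    by apply: measurableT_comp => //; exact: measurable_funB.
  - by move=> y xy; rewrite lee_fin; apply: dP; apply: le_ball xy; exact: ltW.
rewrite integral_cst; last exact: measurable_rV_ball.
rewrite /= lebesgue_rV_ball// -EFinM lee_fin -(mulr_natr r 2) exprMn /e'.
by rewrite le_eqVlt; apply/orP; left; apply/eqP; field; rewrite expf_neq0.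
Qed.

Lemma negligible_bigcup_count d (T : measurableType d)
    (mu : {measure set T -> \bar R}) (I : countType) (F : I -> set T) :
  (forall i, mu.-negligible (F i)) -> mu.-negligible (\bigcup_i F i).
Proof.
move=> NF.
pose G k := if unpickle k is Some i then F i else set0.
apply: (@negligibleS _ _ _ mu (\bigcup_k G k)).
  by move=> x [i _ Fx]; exists (pickle i) => //; rewrite /G pickleK.
apply: negligible_bigcup => k; rewrite /G; case: unpickle => // .
exact: negligible_set0.
Qed.

(** For a constant q, the part of |f - q| where it is at least eps is the
    density of a measure that vanishes where |f - q| < eps, hence it has
    negligible means around almost all these points; near each point f is
    compared in this way with a rational q close to its value there.  The
    restriction to a ball makes the measures finite. *)
Lemma ae_lebesgue_point (f : Rn -> R) :
  leb.-integrable setT (EFin \o f) -> {ae leb, forall x, lebesgue_point f x}.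
Proof.
move=> fint.
have mf : measurable_fun setT f by apply/measurable_EFinP; exact: measurable_int fint.
pose B N : set Rn := ball (0 : Rn) (N.+1%:R : R).
have mB N : measurable (B N) by exact: measurable_rV_ball.
pose g (q : rat) (k N : nat) (y : Rn) : R :=
  `|f y - ratr q| * \1_([set y | k.+1%:R^-1 <= `|f y - ratr q|] `&` B N) y.
have mfq (q : rat) : measurable_fun setT (fun y => `|f y - ratr q| : R).
  by apply: measurableT_comp => //; exact: measurable_funB.
have mge (q : rat) (k : nat) : measurable [set y | (k.+1%:R^-1 : R) <= `|f y - ratr q|].
  have := measurable_fun_ler (@measurable_cst _ _ _ _ setT (k.+1%:R^-1 : R)) (mfq q)
    measurableT (Logic.I : measurable [set true]).
  by rewrite setTI.
have mg q k N : measurable_fun setT (g q k N).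
  apply: measurable_funM; first exact: mfq.
  by apply: measurable_indic; exact: measurableI.
have g0 q k N y : 0 <= g q k N y by rewrite mulr_ge0.
pose nu q k N := density_measure leb (mg q k N) (g0 q k N).
have nufin q k N : (nu q k N setT < +oo)%E.
  have fB : leb.-integrable (B N) (fun y => (`|f y| + `|ratr q|)%:E).
    rewrite (_ : (fun y => _) = (EFin \o (fun y => `|f y|)) \+ cst (`|ratr q|%:E))//.
    apply: integrableD => //.
      by apply: (integrableS measurableT) => //; exact: integrable_norm.
    apply/integrableP; split => //; rewrite integral_cst//=.
    by rewrite lebesgue_rV_ball ?ltr0n// -EFinM ltry.
  apply: (@le_lt_trans _ _ (\int[leb]_(y in B N) (`|f y| + `|ratr q|)%R%:E)%E); last first.
    have /integrableP[_] := fB; apply: le_lt_trans.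
    apply: ge0_le_integral => //.
    - exact: measurable_int fB.
    - apply: measurableT_comp => //; exact: measurable_int fB.
    - by move=> y _; rewrite /= lee_fin ler_norm.
  rewrite /nu /density_measure [leRHS]integral_mkcond; apply: ge0_le_integral => //.
  - by move=> y _; rewrite lee_fin.
  - exact/measurable_EFinP.
  - apply/(measurable_restrictT _ _).1 => //; exact: measurable_int fB.
  - move=> y _; rewrite /g /patch indicE in_setI.
    case: ifPn => _; rewrite ?andbF ?mulr0// andbT lee_fin.
    case: (_ \in _); rewrite ?mulr0 ?mulr1 ?addr_ge0//.
    exact: ler_normB.
pose A q k := ~` [set y | (k.+1%:R^-1 : R) <= `|f y - ratr q|].
have mA q k : measurable (A q k) by exact: measurableC.
have nuA q k N : nu q k N (A q k) = 0%E.
  rewrite /nu /density_measure; apply: integral0_eq => y nAy.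
  by rewrite /g indicE in_setI memNset// andFb mulr0.
pose bad (t : rat * nat * nat * nat) := let: (q, k, N, m) := t in
  not_small (nu q k N) m.+1%:R^-1 `&` A q k.
have Nbad : leb.-negligible (\bigcup_t bad t).
  apply: negligible_bigcup_count => -[[[q k] N] m].
  apply: (null_set_density0 (nufin q k N) (mA q k) (nuA q k N)).
  by rewrite invr_gt0 ltr0n.
apply: negligibleS Nbad => x; apply: contra_notP => nbad e e0.
(* 2 / (k + 1) bounds what g misses of |f - f(x)|, and B(x, r) has measure
   (2 r)^n *)
pose c : R := 2 * 2 ^+ n.
have c0 : 0 < c by rewrite mulr_gt0 ?exprn_gt0.
have e2 : 0 < e / 2 by rewrite divr_gt0.
have [k ke] := exists_natSinv_lt (divr_gt0 e2 c0).
have [m me] := exists_natSinv_lt e2.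
have k0 : (0 : R) < k.+1%:R^-1 by rewrite invr_gt0 ltr0n.
have [|q] := @rat_in_itvoo R (f x - k.+1%:R^-1) (f x + k.+1%:R^-1).
  by rewrite ltrD2l gtrN.
rewrite in_itv /= => qx.
have {}qx : `|f x - ratr q| < k.+1%:R^-1 by rewrite ltr_distlC.
pose N := Num.truncn (`|x| + 1).
have NE : `|x| + 1 < N.+1%:R by exact: truncnS_gt.
have : ~ not_small (nu q k N) m.+1%:R^-1 x.
  move=> ns; apply: nbad; exists (q, k, N, m) => //; split => //=.
  by apply/negP; rewrite -ltNge.
move=> /existsNP[d /not_implyP[d0 /forallNP Hd]].
exists (Num.min d 1); first by rewrite lt_min d0 ltr01.
move=> r /andP[r0]; rewrite lt_min => /andP[rd r1].
have {Hd} nur : (nu q k N (ball x r) <= (m.+1%:R^-1 * r ^+ n)%:E)%E.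
  by rewrite leNgt; apply/negP => H; apply: (Hd r); rewrite r0 rd.
have mxr : measurable (ball x r) by exact: measurable_rV_ball.
have xB : ball x r `<=` B N.
  move=> y; rewrite /B -!ball_normE /= sub0r normrN => xy.
  have := ler_normB x (x - y); rewrite opprB addrC subrK => /le_lt_trans; apply.
  apply: lt_trans NE; rewrite ltrD2l; exact: lt_trans xy r1.
apply: (@le_trans _ _ (\int[leb]_(y in ball x r) ((g q k N y)%:E + (k.+1%:R^-1 *+ 2)%:E))%E).
  apply: ge0_le_integral => //.
  - apply/measurable_EFinP; apply: measurable_funTS.
    by apply: measurableT_comp => //; exact: measurable_funB.
  - by apply: emeasurable_funD => //; apply/measurable_EFinP; exact: measurable_funTS.
  - move=> y xy; rewrite -EFinD lee_fin.
    have yN : y \in B N by rewrite inE; exact: xB.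
    have := ler_distD (ratr q) (f y) (f x); rewrite (distrC (ratr q)) => /le_trans; apply.
    rewrite /g indicE in_setI yN andbT.
    have [h|h] := boolP (y \in _); rewrite ?mulr1 ?mulr0.
      by rewrite lerD2l mulr2n ler_wpDl ?ltW.
    move: h; rewrite notin_setE /= => /negP; rewrite -ltNge => h. by rewrite add0r mulr2n lerD ?ltW.
rewrite ge0_integralD//; last 2 first.
- by move=> y _; rewrite lee_fin.
- by apply/measurable_EFinP; exact: measurable_funTS.
rewrite integral_cst//= lebesgue_rV_ball// -EFinM.
apply: (le_trans (leeD nur (lexx _))); rewrite -EFinD lee_fin.
have rn : 0 < r ^+ n by rewrite exprn_gt0.
rewrite [leRHS](_ : _ = e / 2 * r ^+ n + e / 2 * r ^+ n); last by field.
apply: lerD; first by rewrite ler_pM2r// ltW.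
rewrite -(mulr_natr r 2) exprMn.
rewrite [leLHS](_ : _ = (k.+1%:R^-1 * c) * r ^+ n); last by rewrite /c; ring.
by rewrite ler_pM2r// -ler_pdivlMr// ltW.
Qed.

End lebesgue_points.

(** * The limit of the local lens depth at Lebesgue points *)

Section first_order.
Variables (R : realType) (p : nat) (P : probability 'rV[R]_p R).
Variables (f : 'rV[R]_p -> R) (hf : is_density P f).
Local Notation Rp := 'rV[R]_p.
Local Notation leb := (@lebesgue_rV R p).
Local Notation leb2 := (leb \x leb)%E.
Local Notation Z1 := (Zset 1%:E (0 : Rp)).
Local Notation B := (ball (0 : Rp) 2).

Lemma density_integrable : leb.-integrable setT (EFin \o f).
Proof.
have [mf f0 _] := hf; apply/integrableP; split; first exact/measurable_EFinP.
rewrite (eq_integral (fun x => (f x)%:E)); first exact: density_integral_lty hf.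
by move=> x _ /=; rewrite ger0_norm.
Qed.

Variable x : Rp.

Lemma measurable_oscillation tau :
  measurable_fun setT (fun y : Rp => `|f (x + tau *: y) - f x|).
Proof.
apply: measurableT_comp => //; apply: measurable_funB => //.
exact: (measurable_rescaled hf).
Qed.

Hypothesis Lx : lebesgue_point f x.

Lemma lebesgue_point_rescaled (e : R) : 0 < e -> exists2 d, 0 < d &
  forall tau, 0 < tau < d ->
    (\int[leb]_(y in B) `|f (x + tau *: y) - f x|%:E <= e%:E)%E.
Proof.
have [mf f0 _] := hf.
move=> e0; have e20 : 0 < e / 2 ^+ p by rewrite divr_gt0// exprn_gt0.
have [d d0 dP] := Lx e20.
exists (d / 2); first by rewrite divr_gt0.
move=> tau /andP[t0 td].
have t2 : 0 < tau * 2 < d by apply/andP; split; lra.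
have := dP _ t2.
have tn0 : tau != 0 by rewrite gt_eqF.
rewrite (ge0_integral_scales (scales_affine x tn0)); last 3 first.
- exact: measurable_rV_ball.
- apply/measurable_EFinP; apply: measurable_funTS.
  by apply: measurableT_comp => //; exact: measurable_funB.
- by move=> y _; rewrite lee_fin.
rewrite (_ : _ @^-1` _ = B); last first.
  apply/seteqP; split => y; rewrite /preimage /= -!ball_normE /= opprD addNKr sub0r;
  by rewrite !normrN normrZ gtr0_norm// ltr_pM2l.
rewrite gtr0_norm// exprMn.
set I := (\int[_]_(_ in _) _)%E.
have : (0 <= I)%E by apply: integral_ge0 => y _; rewrite lee_fin.
have tp : 0 < tau ^+ p by rewrite exprn_gt0.
case: I => [I _| |//].
  rewrite -EFinM !lee_fin (_ : e / _ * _ = tau ^+ p * e); first by rewrite ler_pM2l.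
  by field; rewrite expf_neq0.
by move=> _; rewrite mulry gtr0_sg// mul1e.
Qed.

(* the Lebesgue measure of the ball of radius 2 *)
Let K : R := (2 *+ 2) ^+ p.

(** With a_i = |f(x + tau y_i) - f(x)|, the integrand differs from f(x)^2 by at
    most a_1 a_2 + a_1 f(x) + f(x) a_2.  Enlarging Z_1(0) to a product of balls
    makes the integral of each of these terms a product of integrals. *)
Lemma rescaled_integral_bound (e tau : R) : 0 < e -> 0 < tau ->
  (\int[leb]_(y in B) `|f (x + tau *: y) - f x|%:E <= e%:E)%E ->
  `|Lambda1 R p * f x ^+ 2 -
    \int[leb2]_(z in Z1) (f (x + tau *: z.1) * f (x + tau *: z.2))|
  <= e * e + 2 * (f x * K) * e.
Proof.
move=> e0 t0 De; have [mf f0 _] := hf.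
pose a (y : Rp) := `|f (x + tau *: y) - f x|.
pose ff (z : Rp * Rp) := f (x + tau *: z.1) * f (x + tau *: z.2).
have ma : measurable_fun setT a by exact: measurable_oscillation.
have a0 y : 0 <= a y by exact: normr_ge0.
have mB : measurable B by exact: measurable_rV_ball.
have mBB : measurable (B `*` B) by exact: measurableX.
have mZ : measurable Z1 by exact: measurable_Z1.
have intf := integrable_rescaled hf x t0.
have intc : leb2.-integrable Z1 (EFin \o cst (f x ^+ 2)).
  apply/integrableP; split; first by apply/measurable_EFinP.
  rewrite (_ : (fun _ => _) = cst `|(f x ^+ 2)%:E|%E)// integral_cst//.
  by apply: lte_mul_pinfty => //; exact: leb2_Z1_lty.
have -> : Lambda1 R p * f x ^+ 2 = \int[leb2]_(z in Z1) (f x ^+ 2).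
  by rewrite Rintegral_cst// mulrC.
rewrite distrC -RintegralB// -lee_fin EFin_normr_Rintegral//; last first.
  exact: (integrableB mZ intf intc).
have mff : measurable_fun setT (fun z => ff z - f x ^+ 2).
  by apply: measurable_funB => //; exact: (measurable_rescaled2 hf x tau).
apply: (le_trans (le_abse_integral _ mZ _)).
  by apply/measurable_EFinP; exact: measurable_funTS.
have mfst (g : Rp -> R) : measurable_fun setT g ->
    measurable_fun setT (fun z : Rp * Rp => g z.1).
  by move=> mg; exact: (measurableT_comp mg measurable_fst).
have msnd (g : Rp -> R) : measurable_fun setT g ->
    measurable_fun setT (fun z : Rp * Rp => g z.2).
  by move=> mg; exact: (measurableT_comp mg measurable_snd).
pose A1 (z : Rp * Rp) := a z.1 * a z.2.
pose A2 (z : Rp * Rp) := a z.1 * cst (f x) z.2.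
pose A3 (z : Rp * Rp) := cst (f x) z.1 * a z.2.
have mA1 : measurable_fun setT A1.
  by apply: measurable_funM; [exact: mfst|exact: msnd].
have mA2 : measurable_fun setT A2 by apply: measurable_funM => //; exact: mfst.
have mA3 : measurable_fun setT A3 by apply: measurable_funM => //; exact: msnd.
have A10 z : 0 <= A1 z by apply: mulr_ge0 => /=.
have A20 z : 0 <= A2 z by apply: mulr_ge0 => /=.
have A30 z : 0 <= A3 z by apply: mulr_ge0 => /=.
apply: (@le_trans _ _ (\int[leb2]_(z in B `*` B) (A1 z + A2 z + A3 z)%:E)%E).
  apply: (@le_trans _ _ (\int[leb2]_(z in Z1) (A1 z + A2 z + A3 z)%:E)%E).
    apply: ge0_le_integral => //.
    - apply: measurableT_comp => //.
      by apply/measurable_EFinP; exact: measurable_funTS.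
    - apply/measurable_EFinP; apply: measurable_funTS.
      by apply: measurable_funD => //; exact: measurable_funD.
    - move=> z _; rewrite /= lee_fin /A1 /A2 /A3 /a /ff /=.
      set u := f (x + _ *: z.1); set v := f (x + _ *: z.2).
      rewrite (_ : _ - _ = (u - f x) * (v - f x) + (u - f x) * f x + f x * (v - f x));
        last by ring.
      apply: (le_trans (ler_normD _ _)); rewrite lerD//; last by rewrite normrM ger0_norm.
      apply: (le_trans (ler_normD _ _)); rewrite !normrM lerD//.
      by rewrite (ger0_norm (f0 x)).
  apply: ge0_subset_integral => //; last exact: Z1_sub.
    apply/measurable_EFinP; apply: measurable_funTS.
    by apply: measurable_funD => //; exact: measurable_funD.
  by move=> z _; rewrite lee_fin !addr_ge0.
have mE (g : Rp * Rp -> R) : measurable_fun setT g ->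
    measurable_fun (B `*` B) (fun z => (g z)%:E).
  by move=> mg; apply/measurable_EFinP; exact: measurable_funTS.
under eq_integral do rewrite 2!EFinD.
rewrite ge0_integralD//; last 4 first.
- by move=> z _; rewrite adde_ge0 ?lee_fin.
- by apply: emeasurable_funD; exact: mE.
- by move=> z _; rewrite lee_fin.
- exact: mE.
rewrite ge0_integralD//; last 4 first.
- by move=> z _; rewrite lee_fin.
- exact: mE.
- by move=> z _; rewrite lee_fin.
- exact: mE.
have fx0 (y : Rp) : 0 <= cst (f x) y by exact: f0.
rewrite !integral_tensor// -/a.
have E : (\int[leb]_(y in B) (cst (f x) y)%:E = (f x * K)%:E)%E.
  by rewrite [LHS](integral_cst leb mB (f x)%:E)/= lebesgue_rV_ball.
rewrite E; move: De; rewrite -/a; set D := (\int[_]_(_ in _) _)%E.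
have : (0 <= D)%E by apply: integral_ge0 => y _; rewrite lee_fin.
case: D => [D| |]//; rewrite !lee_fin => D0 De.
have fK : 0 <= f x * K by rewrite mulr_ge0// exprn_ge0.
nra.
Qed.

Lemma cvg_rescaled_LLD :
  (tau ^+ (2 * p))^-1 * LLD P x tau%:E @[tau --> 0^'+] --> Lambda1 R p * f x ^+ 2.
Proof.
have [mf f0 _] := hf.
have K0 : 0 <= K by rewrite exprn_ge0.
have fK : 0 <= f x * K by rewrite mulr_ge0.
apply/cvgrPdist_le => e e0.
(* e' is chosen so that e' e' + 2 f(x) K e' <= e *)
pose M := 1 + 2 * (f x * K).
have M0 : 0 < M by rewrite /M; lra.
pose e' := Num.min 1 (e / M).
have e'0 : 0 < e' by rewrite lt_min ltr01 divr_gt0.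
have e'1 : e' <= 1 by rewrite ge_min lexx.
have e'M : e' * M <= e by rewrite -ler_pdivlMr// ge_min lexx orbT.
have [d d0 dP] := lebesgue_point_rescaled e'0.
near=> tau.
have t0 : 0 < tau by near: tau; exact: nbhs_right_gt.
rewrite (LLD_rescaled hf)//.
apply: (le_trans (rescaled_integral_bound e'0 t0 _)).
  apply: dP; rewrite t0 /=; near: tau; exact: nbhs_right_lt.
rewrite /M in e'M; nra.
Unshelve. all: by end_near. Qed.

Lemma cvg_LLD_lebesgue_point :
  (tau ^+ (2 * p) * Lambda1 R p)^-1 * LLD P x tau%:E @[tau --> 0^'+] --> f x ^+ 2.
Proof.
have L0 : Lambda1 R p != 0 by rewrite gt_eqF// Lambda1_gt0.
have -> : f x ^+ 2 = (Lambda1 R p)^-1 * (Lambda1 R p * f x ^+ 2) by rewrite mulKf.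
under eq_fun do rewrite invfM mulrAC mulrC.
apply: cvgM cvg_rescaled_LLD; exact: cvg_cst.
Qed.

End first_order.

(** * Second order Taylor expansion *)

(** Stated with the modulus of continuity of the second derivative instead of
    a third derivative: two applications of the mean value theorem. *)
Lemma taylor2_segment (R : realType) (g g1 g2 : R -> R) (tau e : R) : 0 < tau ->
  (forall t : R, is_derive t (1 : R) g (g1 t)) ->
  (forall t : R, is_derive t (1 : R) g1 (g2 t)) ->
  (forall t, 0 < t < tau -> `|g2 t - g2 0| <= e) ->
  `|g tau - (g 0 + tau * g1 0 + tau ^+ 2 / 2 * g2 0)| <= tau ^+ 2 * e.
Proof.
move=> t0 dg dg1 g2e.
have within_cont (h dh : R -> R) (b : R) : (forall t : R, is_derive t (1 : R) h (dh t)) ->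
    {within `[0, b], continuous h}.
  move=> dh_; apply: continuous_subspaceT => t.
  apply: differentiable_continuous; apply/derivable1_diffP.
  by have [] := dh_ t.
pose h1 : R -> R := g1 - (g2 0 \*: id).
have dh1 t : is_derive t (1 : R) h1 (g2 t - g2 0).
  by have := dg1 t => ?; apply: is_derive_eq; rewrite [_ *: _]mulr1.
pose h : R -> R := g - (g1 0 \*: id) - ((g2 0 / 2) \*: (id ^+ 2)).
have dh t : is_derive t (1 : R) h (h1 t - h1 0).
  have := dg t => ?; apply: is_derive_eq.
  rewrite /h1 !fctE /= -![_ *: _]/(_ * _) expr1.
  by field.
have [c /[!in_itv]/= /andP[c0 ct] hE] := MVT t0 (fun t _ => dh t) (within_cont _ _ tau dh).
have [b /[!in_itv]/= /andP[b0 bc] h1E] := MVT c0 (fun t _ => dh1 t) (within_cont _ _ c dh1).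
have -> : g tau - (g 0 + tau * g1 0 + tau ^+ 2 / 2 * g2 0) = h tau - h 0.
  by rewrite /h !fctE /= -![_ *: _]/(_ * _) !expr2; field.
rewrite hE h1E !subr0 !normrM (gtr0_norm t0) (gtr0_norm c0).
have eb : `|g2 b - g2 0| <= e by apply: g2e; rewrite b0 (lt_trans bc).
have e0 : 0 <= e by apply: le_trans eb.
rewrite expr2 mulrC -mulrA ler_pM2l// mulrC.
by apply: ler_pM => //; exact: ltW.
Qed.

Section taylor.
Variables (R : realType) (p : nat).
Local Notation Rp := 'rV[R]_p.
Implicit Types (f : Rp -> R) (x y : Rp).

(** The difference quotients of f along the line are those that define its
    directional derivative. *)
Lemma is_derive_line f x y (t : R) : differentiable f (x + t *: y) ->
  is_derive t (1 : R) (fun s : R => f (x + s *: y)) (inner (gradient f (x + t *: y)) y).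
Proof.
move=> df; have dfy := @diff_derivable _ _ _ f (x + t *: y) y df.
have E : inner (gradient f (x + t *: y)) y = 'D_y f (x + t *: y).
  rewrite deriveE//; set D := 'd f _; rewrite [y in RHS]row_sum_delta linear_sum /inner.
  apply: eq_bigr => i _.
  by rewrite linearZ/= /D -deriveE// /gradient mxE mulrC.
have H : (fun h : R => h^-1 *: (((fun s : R => f (x + s *: y)) \o shift t) (h *: (1 : R))
            - f (x + t *: y))) =
         (fun h : R => h^-1 *: ((f \o shift (x + t *: y)) (h *: y) - f (x + t *: y))).
  apply/funext => h /=; congr (_ *: (f _ - _)).
  by rewrite [h *: 1]mulr1 scalerDl addrCA.
rewrite E; split; first by rewrite /derivable H.
by rewrite /derive H.
Qed.

Lemma CdiffS k f : Cdiff k.+1 f -> Cdiff k f.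
Proof.
elim: k f => [|k IH] f [df H].
  by move=> x; exact: differentiable_continuous.
by split => // i; exact: IH.
Qed.

Definition hess_form f x y : R := (y *m hessian f x *m y^T) 0 0.

Lemma hess_formE f x y :
  hess_form f x y = \sum_(i < p) inner (gradient (partial i f) x) y * y 0 i.
Proof.
rewrite /hess_form mxE; apply: eq_bigr => i _; rewrite !mxE; congr (_ * _).
by rewrite /inner; apply: eq_bigr => j _; rewrite /gradient /hessian !mxE mulrC.
Qed.

Lemma is_derive_line2 f x y (t : R) : (forall i, differentiable (partial i f) (x + t *: y)) ->
  is_derive t (1 : R) (fun s : R => inner (gradient f (x + s *: y)) y)
    (hess_form f (x + t *: y) y).
Proof.
move=> df.
rewrite (_ : (fun s => _) = \sum_(i < p) (y 0 i \*: (fun s : R => partial i f (x + s *: y)))).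
  rewrite hess_formE.
  have H i := is_derive_line (df i).
  by apply: is_derive_eq; apply: eq_bigr => i _; rewrite [_ *: _]mulrC.
apply/funext => s; rewrite fct_sumE /inner; apply: eq_bigr => i _.
by rewrite /gradient !mxE mulrC.
Qed.

Lemma ball2_coord (y : Rp) i : ball (0 : Rp) 2 y -> `|y 0 i| <= 2.
Proof.
by move=> /(rV_ballP _ _ (ltr0n R 2))/(_ i); rewrite mxE sub0r normrN => /ltW.
Qed.

Lemma inner_bound (v y : Rp) : ball (0 : Rp) 2 y ->
  `|inner v y| <= \sum_(i < p) `|v 0 i| * 2.
Proof.
move=> y2; apply: (le_trans (ler_norm_sum _ _ _)); apply: ler_sum => i _.
by rewrite normrM ler_wpM2l//; exact: ball2_coord.
Qed.

Lemma hess_form_dist f x x' y (e : R) : ball (0 : Rp) 2 y ->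
  (forall i j, `|partial j (partial i f) x' - partial j (partial i f) x| <= e) ->
  `|hess_form f x' y - hess_form f x y| <= (p * p * 4)%:R * e.
Proof.
move=> y2 He; rewrite !hess_formE -sumrB.
apply: (le_trans (ler_norm_sum _ _ _)).
apply: (@le_trans _ _ (\sum_(i < p) (\sum_(j < p) e * 2) * 2)).
  apply: ler_sum => i _; rewrite -mulrBl normrM.
  apply: ler_pM => //; last exact: ball2_coord.
  rewrite /inner -sumrB; apply: (le_trans (ler_norm_sum _ _ _)).
  apply: ler_sum => j _; rewrite -mulrBl normrM /gradient !mxE.
  by apply: ler_pM => //; exact: ball2_coord.
have sum_cst (a : R) : \sum_(i < p) a = p%:R * a by rewrite sumr_const card_ord mulr_natl.
rewrite !sum_cst !natrM.
by rewrite le_eqVlt; apply/orP; left; apply/eqP; ring.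
Qed.

Lemma hess_form_bound f x y : ball (0 : Rp) 2 y ->
  `|hess_form f x y| <= \sum_(i < p) (\sum_(j < p) `|partial j (partial i f) x| * 2) * 2.
Proof.
move=> y2; rewrite hess_formE; apply: (le_trans (ler_norm_sum _ _ _)).
apply: ler_sum => i _; rewrite normrM.
apply: ler_pM => //; last exact: ball2_coord.
apply: (le_trans (inner_bound _ y2)); by apply: ler_sum => j _; rewrite /gradient mxE.
Qed.

(** The second derivative along the line directed by y is the Hessian form at
    y, whose variation is controlled, uniformly in y, by that of the finitely
    many second partial derivatives. *)
Lemma taylor2_uniform f x (e : R) : Cdiff 2 f -> 0 < e -> exists2 d, 0 < d &
  forall tau, 0 < tau < d -> forall y, ball (0 : Rp) 2 y ->
   `|f (x + tau *: y) -
     (f x + tau * inner (gradient f x) y + tau ^+ 2 / 2 * hess_form f x y)|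
   <= tau ^+ 2 * e.
Proof.
move=> [df Cf] e0.
pose e' := e / (p * p * 4).+1%:R.
have e'0 : 0 < e' by rewrite divr_gt0// ltr0n.
have : \forall z \near x, forall ij : 'I_p * 'I_p,
    `|partial ij.2 (partial ij.1 f) z - partial ij.2 (partial ij.1 f) x| <= e'.
  have H (ij : 'I_p * 'I_p) : \forall z \near x,
      `|partial ij.2 (partial ij.1 f) z - partial ij.2 (partial ij.1 f) x| <= e'.
    have [_ /(_ ij.2)] := Cf ij.1 => /(_ x)/cvgrPdist_le/(_ e' e'0).
    apply: filterS => z zP.
    rewrite distrC.
    exact: zP.
  exact: (@filter_forall _ _ _ (nbhs x) _ H).
move=> /nbhs_ballP[d /= d0 dP].
exists (d / 2); first by rewrite divr_gt0.
move=> tau /andP[t0 td] y y2.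
have := @taylor2_segment _ (fun s => f (x + s *: y))
  (fun s => inner (gradient f (x + s *: y)) y) (fun s => hess_form f (x + s *: y) y) tau e t0.
rewrite scale0r addr0; apply.
- by move=> t; exact: is_derive_line.
- by move=> t; apply: is_derive_line2 => i; have [] := Cf i.
- move=> t /andP[t0' tt].
  apply: (@le_trans _ _ ((p * p * 4)%:R * e')).
    apply: hess_form_dist => // i j; apply: (dP _ _ (i, j)).
    apply/rV_ballP => // k; rewrite !mxE opprD addrA subrr sub0r normrN normrM gtr0_norm//.
    apply: (@le_lt_trans _ _ (t * 2)); last by lra.
    by rewrite ler_pM2l//; exact: ball2_coord.
  rewrite /e' mulrCA -[leRHS]mulr1 ler_pM2l// ler_pdivrMr ?ltr0n// mul1r ler_nat//.
Qed.

End taylor.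

(** * The second order term *)

Lemma Rintegral_scales1 d (T : measurableType d) (R : realType)
    (m : {measure set T -> \bar R}) (phi : T -> T) (D : set T) (g : T -> R) :
  scales 1 m phi -> measurable D -> measurable_fun setT g ->
  phi @^-1` D = D -> m.-integrable D (EFin \o (g \o phi)) ->
  \int[m]_(x in D) g x = \int[m]_(x in D) g (phi x).
Proof.
move=> [_ mphi E] mD mg phiD ig; rewrite /Rintegral; congr fine.
transitivity (\int[image_measure m mphi]_(x in D) (g x)%:E)%E.
  apply: eq_measure_integral => A mA _.
  by rewrite /= /image_measure /pushforward -[LHS]E// mul1e.
rewrite [LHS](integral_pushforward (f := EFin \o g) mphi); first by rewrite phiD.
- exact/measurable_EFinP.
- by rewrite phiD.
- exact: mD.
Qed.

Section second_order.
Variables (R : realType) (p : nat) (P : probability 'rV[R]_p R).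
Variables (f : 'rV[R]_p -> R) (hf : is_density P f).
Local Notation Rp := 'rV[R]_p.
Local Notation leb := (@lebesgue_rV R p).
Local Notation leb2 := (leb \x leb)%E.
Local Notation Z1 := (Zset 1%:E (0 : Rp)).
Local Notation B := (ball (0 : Rp) 2).

Lemma integrable_Z1 (g : Rp * Rp -> R) (M : R) : measurable_fun setT g ->
  (forall z, Z1 z -> `|g z| <= M) -> leb2.-integrable Z1 (EFin \o g).
Proof.
move=> mg gM; apply: measurable_bounded_integrable.
- exact: measurable_Z1.
- exact: leb2_Z1_lty.
- exact: measurable_funTS.
- exists M; split; first exact: num_real.
  by move=> N MN z /gM /le_trans; apply; exact: ltW.
Qed.

Lemma preimage_opp_Z1 :
  (fun z : Rp * Rp => (0 + (-1) *: z.1, 0 + (-1) *: z.2)) @^-1` Z1 = Z1.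
Proof.
apply/seteqP; split => -[y z]; rewrite /preimage /Zset /= !add0r !scaleN1r;
  by rewrite -opprD !eucl_normN.
Qed.

Lemma preimage_swap_Z1 : (fun z : Rp * Rp => (z.2, z.1)) @^-1` Z1 = Z1.
Proof.
apply/seteqP; split => -[y z]; rewrite /preimage /Zset /= !sub0r !eucl_normN;
  by rewrite maxC -(eucl_normN (_ - _)) opprB.
Qed.

Lemma measurable_inner d (T : measurableType d) (v : Rp) (g : T -> Rp) :
  measurable_fun setT g -> measurable_fun setT (fun t => inner v (g t)).
Proof.
move=> mg; apply: measurable_sum => i; apply: measurable_funM => //.
exact: (measurableT_comp (measurable_coord i) mg).
Qed.

Lemma measurable_hess_form d (T : measurableType d) (x : Rp) (g : T -> Rp) :
  measurable_fun setT g -> measurable_fun setT (fun t => hess_form f x (g t)).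
Proof.
move=> mg; under eq_fun do rewrite hess_formE.
apply: measurable_sum => i; apply: measurable_funM; first exact: measurable_inner.
exact: (measurableT_comp (measurable_coord i) mg).
Qed.

Variable x : Rp.
Local Notation L := (inner (gradient f x)).
Local Notation Q := (hess_form f x).

(* M bounds f(x), and the linear and the quadratic form on the ball of radius 2 *)
Let M := 1 + f x + \sum_(i < p) `|gradient f x 0 i| * 2 +
  \sum_(i < p) (\sum_(j < p) `|partial j (partial i f) x| * 2) * 2.

Let M_bound : [/\ 1 <= M, `|f x| <= M & forall y, B y -> `|L y| <= M /\ `|Q y| <= M].
Proof.
have [_ f0 _] := hf; have fx0 := f0 x.
set S1 := \sum_(i < p) `|gradient f x 0 i| * 2.
have S10 : 0 <= S1 by apply: sumr_ge0 => i _; rewrite mulr_ge0.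
set S2 := \sum_(i < p) (\sum_(j < p) `|partial j (partial i f) x| * 2) * 2.
have S20 : 0 <= S2.
  apply: sumr_ge0 => i _; rewrite mulr_ge0//.
  by apply: sumr_ge0 => j _; rewrite mulr_ge0.
rewrite /M -/S1 -/S2; split; first by lra.
  by rewrite ger0_norm//; lra.
move=> y yB; have := inner_bound (gradient f x) yB; rewrite -/S1 => h1.
have := hess_form_bound f x yB; rewrite -/S2 => h2; split; lra.
Qed.

(** Z_1(0) is invariant under (x1, x2) |-> (-x1, -x2), which changes the sign of
    the integrand. *)
Lemma integral_linear_Z1 (g : Rp * Rp -> Rp) : measurable_fun setT g ->
  (forall z, Z1 z -> B (g z)) ->
  (forall z, g (0 + (-1) *: z.1, 0 + (-1) *: z.2) = - g z) ->
  \int[leb2]_(z in Z1) L (g z) = 0.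
Proof.
move=> mg gB gN; have [M1 _ MB] := M_bound.
have mL : measurable_fun setT (fun z => L (g z)) by exact: measurable_inner.
have LN (v y : Rp) : inner v (- y) = - inner v y.
  by rewrite /inner -sumrN; apply: eq_bigr => i _; rewrite mxE mulrN.
have N1 : (-1 : R) != 0 by rewrite oppr_eq0 oner_eq0.
have S := scales_prod (scales_affine (0 : Rp) N1) (scales_affine (0 : Rp) N1).
rewrite normrN1 expr1n mulr1 in S.
have iL : leb2.-integrable Z1 (EFin \o (fun z => L (g z))).
  by apply: (integrable_Z1 (M := M)) => // z /gB/MB[].
have iLphi : leb2.-integrable Z1
    (EFin \o (fun z : Rp * Rp => L (g (0 + (-1) *: z.1, 0 + (-1) *: z.2)))).
  apply: (integrable_Z1 (M := M)).
    by apply: (measurableT_comp mL); case: S.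
  by move=> z /gB/MB[LM _]; rewrite gN LN normrN.
have H := Rintegral_scales1 S (@measurable_Z1 R p) mL preimage_opp_Z1 iLphi.
have E : \int[leb2]_(z in Z1) L (g (0 + (-1) *: z.1, 0 + (-1) *: z.2)) =
    - \int[leb2]_(z in Z1) L (g z).
  transitivity (\int[leb2]_(z in Z1) (-1 * L (g z))).
    by apply: eq_Rintegral => z _; rewrite gN LN mulN1r.
  by rewrite -[RHS]mulN1r; apply: RintegralZl => //; exact: measurable_Z1.
move: H; rewrite E; set I := \int[_]_(_ in _) _; lra.
Qed.

Lemma integral_hess_form_swap :
  \int[leb2]_(z in Z1) Q z.2 = \int[leb2]_(z in Z1) Q z.1.
Proof.
have [M1 _ MB] := M_bound.
rewrite (Rintegral_scales1 (scales_swap leb) (@measurable_Z1 R p) _ preimage_swap_Z1)//.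
  exact: measurable_hess_form.
apply: (integrable_Z1 (M := M)).
  exact: (@measurable_hess_form _ _ x fst measurable_fst).
by move=> z /Z1_sub[/MB[]].
Qed.

(** In the product of two second order expansions, every term that is not kept
    has a factor t^3 or a factor t^2 e; the constants are uniform as long as all
    coefficients are at most N. *)
Let product_remainder (N t e c l1 l2 q1 q2 u v : R) :
  1 <= N -> 0 < t <= 1 -> 0 < e <= 1 -> `|c| <= N ->
  `|l1| <= N -> `|l2| <= N -> `|q1| <= N -> `|q2| <= N ->
  `|u - (c + t * l1 + t ^+ 2 / 2 * q1)| <= t ^+ 2 * e ->
  `|v - (c + t * l2 + t ^+ 2 / 2 * q2)| <= t ^+ 2 * e ->
  `|u * v - (c ^+ 2 + t * c * (l1 + l2) + t ^+ 2 * (c / 2 * (q1 + q2) + l1 * l2))|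
  <= t ^+ 2 * (2 * N ^+ 2 * t + 7 * N * e).
Proof.
move=> N1 /andP[t0 t1] /andP[e0 e1] cN l1N l2N q1N q2N.
set a := c + t * l1 + _; set b := c + t * l2 + _ => ua vb.
have tt : t ^+ 2 <= 1 by rewrite expr_le1// ltW.
have t20 : 0 <= t ^+ 2 by rewrite exprn_ge0// ltW.
have bnd (l q : R) : `|l| <= N -> `|q| <= N -> `|c + t * l + t ^+ 2 / 2 * q| <= 3 * N.
  move=> lN qN.
  apply: (le_trans (ler_normD _ _)).
  apply: (le_trans (lerD (ler_normD _ _) (lexx _))).
  rewrite (normrM t l) (gtr0_norm t0) (normrM (t ^+ 2 / 2) q) (ger0_norm (_ : 0 <= t ^+ 2 / 2));
    last by rewrite divr_ge0.
  have h1 : t * `|l| <= N by rewrite -[leRHS]mul1r ler_pM// ltW.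
  have h2 : t ^+ 2 / 2 * `|q| <= N.
    by rewrite -[leRHS]mul1r; apply: ler_pM => //; lra.
  lra.
have aN := bnd _ _ l1N q1N; have bN := bnd _ _ l2N q2N.
have vN : `|v| <= 4 * N.
  rewrite -(subrK b v); apply: (le_trans (ler_normD _ _)).
  have : `|v - b| <= 1 by apply: (le_trans vb); rewrite -[leRHS]mul1r ler_pM// ltW.
  rewrite -/b in bN; lra.
rewrite (_ : u * v - _ = (u - a) * v + a * (v - b) +
  t ^+ 2 * (t * (l1 * q2 + l2 * q1) / 2 + t ^+ 2 * (q1 * q2) / 4)); last first.
  by rewrite /a /b; field.
apply: (le_trans (ler_normD _ _)).
rewrite [leRHS]mulrDr [leLHS]addrC; apply: lerD.
  rewrite normrM (ger0_norm t20) ler_wpM2l//.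
  apply: (le_trans (ler_normD _ _)).
  have NN (r s : R) : `|r| <= N -> `|s| <= N -> `|r * s| <= N ^+ 2.
    by move=> rN sN; rewrite normrM expr2 ler_pM.
  have h1 := NN _ _ l1N q2N; have h2 := NN _ _ l2N q1N; have h3 := NN _ _ q1N q2N.
  have h4 : `|t * (l1 * q2 + l2 * q1) / 2| <= t * N ^+ 2.
    rewrite -mulrA (normrM t) (gtr0_norm t0) ler_wpM2l ?(ltW t0)//.
    rewrite normrM (ger0_norm (_ : 0 <= 2^-1)) ?invr_ge0//.
    have := ler_normD (l1 * q2) (l2 * q1); lra.
  have h5 : `|t ^+ 2 * (q1 * q2) / 4| <= t * N ^+ 2.
    rewrite -mulrA (normrM (t ^+ 2)) (ger0_norm t20) (normrM (q1 * q2)).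
    rewrite (ger0_norm (_ : 0 <= 4^-1)) ?invr_ge0// mulrA.
    have h6 : t ^+ 2 * `|q1 * q2| <= t * N ^+ 2.
      by apply: ler_pM => //; rewrite expr2 ger_pMr.
    have : 0 <= t ^+ 2 * `|q1 * q2| by rewrite mulr_ge0.
    lra.
  lra.
apply: (le_trans (ler_normD _ _)); rewrite !normrM.
have h1 : `|u - a| * `|v| <= t ^+ 2 * e * (4 * N) by exact: ler_pM.
have h2 : `|a| * `|v - b| <= 3 * N * (t ^+ 2 * e) by exact: ler_pM.
lra.
Qed.

(** The integral over Z_1(0) of the product of the two expansions, truncated at
    order 2, is Lambda_1 f(x)^2 + tau^2 h(x): the linear terms vanish by the
    symmetry x |-> -x, and the two Hessian terms are equal by the symmetry that
    exchanges the two points. *)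
Lemma cvg_LLD_second_order : Cdiff 2 f ->
  (tau ^+ 2)^-1 *
    ((tau ^+ (2 * p))^-1 * LLD P x tau%:E - Lambda1 R p * f x ^+ 2)
    @[tau --> 0^'+] --> hfun f x.
Proof.
move=> Cf; have [M1 fM MB] := M_bound.
have mZ := @measurable_Z1 R p.
set c := f x.
have L1B z : Z1 z -> `|L z.1| <= M by move=> /Z1_sub[/MB[]].
have L2B z : Z1 z -> `|L z.2| <= M by move=> /Z1_sub[_ /MB[]].
have Q1B z : Z1 z -> `|Q z.1| <= M by move=> /Z1_sub[/MB[]].
have Q2B z : Z1 z -> `|Q z.2| <= M by move=> /Z1_sub[_ /MB[]].
have mL1 : measurable_fun setT (fun z : Rp * Rp => L z.1) by exact: measurable_inner.
have mL2 : measurable_fun setT (fun z : Rp * Rp => L z.2) by exact: measurable_inner.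
have mQ1 : measurable_fun setT (fun z : Rp * Rp => Q z.1) by exact: measurable_hess_form.
have mQ2 : measurable_fun setT (fun z : Rp * Rp => Q z.2) by exact: measurable_hess_form.
have iL1 := integrable_Z1 mL1 L1B; have iL2 := integrable_Z1 mL2 L2B.
have iQ1 := integrable_Z1 mQ1 Q1B; have iQ2 := integrable_Z1 mQ2 Q2B.
have iLL : leb2.-integrable Z1 (EFin \o (fun z : Rp * Rp => L z.1 * L z.2)).
  apply: (integrable_Z1 (M := M * M)); first exact: measurable_funM.
  by move=> z Zz; rewrite normrM ler_pM ?L1B ?L2B.
have ic (r : R) : leb2.-integrable Z1 (EFin \o cst r).
  by apply: (integrable_Z1 (M := `|r|)).
have intL1 : \int[leb2]_(z in Z1) L z.1 = 0.
  apply: (integral_linear_Z1 (g := fst)) => [|z /Z1_sub[]//|z]; first exact: measurable_fst.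
  by rewrite /= add0r scaleN1r.
have intL2 : \int[leb2]_(z in Z1) L z.2 = 0.
  apply: (integral_linear_Z1 (g := snd)) => [|z /Z1_sub[]//|z]; first exact: measurable_snd.
  by rewrite /= add0r scaleN1r.
have hE : hfun f x = c * \int[leb2]_(z in Z1) Q z.1 + \int[leb2]_(z in Z1) (L z.1 * L z.2).
  by [].
pose T (t : R) (z : Rp * Rp) := c ^+ 2 + t * c * (L z.1 + L z.2) +
  t ^+ 2 * (c / 2 * (Q z.1 + Q z.2) + L z.1 * L z.2).
have iZl (r : R) (g : Rp * Rp -> R) : leb2.-integrable Z1 (EFin \o g) ->
    leb2.-integrable Z1 (EFin \o (fun z => r * g z)).
  by move=> ig; have := integrableZl mZ r ig; apply: eq_integrable.
have iD (g h : Rp * Rp -> R) : leb2.-integrable Z1 (EFin \o g) ->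
    leb2.-integrable Z1 (EFin \o h) -> leb2.-integrable Z1 (EFin \o (fun z => g z + h z)).
  by move=> ig ih; have := integrableD mZ ig ih; apply: eq_integrable.
have iLs := iD _ _ iL1 iL2; have iQs := iD _ _ iQ1 iQ2.
have iH := iD _ _ (iZl (c / 2) _ iQs) iLL.
have iT t : leb2.-integrable Z1 (EFin \o T t).
  exact: (iD _ _ (iD _ _ (ic (c ^+ 2)) (iZl (t * c) _ iLs)) (iZl (t ^+ 2) _ iH)).
have intT t : \int[leb2]_(z in Z1) T t z = Lambda1 R p * c ^+ 2 + t ^+ 2 * hfun f x.
  rewrite RintegralD//; last 2 first.
  - exact: (iD _ _ (ic (c ^+ 2)) (iZl (t * c) _ iLs)).
  - exact: (iZl (t ^+ 2) _ iH).
  rewrite RintegralD//; last 2 first.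
  - exact: ic.
  - exact: (iZl (t * c) _ iLs).
  rewrite Rintegral_cst// RintegralZl// RintegralD// intL1 intL2.
  rewrite RintegralZl// RintegralD//; last exact: iZl.
  rewrite RintegralZl// RintegralD// integral_hess_form_swap hE.
  by rewrite -[fine _]/(Lambda1 R p); field.
have L0 := Lambda1_gt0 R p.
apply/cvgrPdist_le => e e0.
(* e1 and d' make both parts of the remainder at most tau^2 eta / 2 *)
pose eta := e / Lambda1 R p.
have eta0 : 0 < eta by rewrite divr_gt0.
pose e1 := Num.min 1 (eta / (14 * M)).
have M0 : 0 < M by lra.
have e10 : 0 < e1 by rewrite lt_min ltr01 divr_gt0// mulr_gt0.
have e11 : e1 <= 1 by rewrite ge_min lexx.
have e1M : 7 * M * e1 <= eta / 2.
  have : e1 * (14 * M) <= eta by rewrite -ler_pdivlMr ?mulr_gt0// ge_min lexx orbT.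
  lra.
have [d d0 dP] := taylor2_uniform x Cf e10.
pose d' := eta / (4 * M ^+ 2).
have M20 : 0 < M ^+ 2 by rewrite exprn_gt0.
have d'0 : 0 < d' by rewrite divr_gt0// mulr_gt0.
near=> tau.
have t0 : 0 < tau by near: tau; exact: nbhs_right_gt.
have t1 : tau <= 1 by near: tau; exact: nbhs_right_le.
have td : tau < d by near: tau; exact: nbhs_right_lt.
have td' : tau < d' by near: tau; exact: nbhs_right_lt.
have tM : 2 * M ^+ 2 * tau <= eta / 2.
  have : tau * (4 * M ^+ 2) < eta by rewrite -ltr_pdivlMr ?mulr_gt0.
  lra.
have t20 : 0 < tau ^+ 2 by rewrite exprn_gt0.
rewrite (LLD_rescaled hf)//.
set I := \int[_]_(_ in _) _.
have -> : hfun f x - (tau ^+ 2)^-1 * (I - Lambda1 R p * f x ^+ 2) =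
    (tau ^+ 2)^-1 * (\int[leb2]_(z in Z1) T tau z - I).
  by rewrite intT -/c; field; rewrite gt_eqF.
rewrite normrM gtr0_norm ?invr_gt0// mulrC ler_pdivrMr// mulrC.
have iF := integrable_rescaled hf x t0.
rewrite distrC /I -RintegralB//.
apply: (le_trans (le_normr_Rintegral mZ (integrableB mZ iF (iT tau)))).
have -> : tau ^+ 2 * e = \int[leb2]_(z in Z1) (tau ^+ 2 * eta).
  rewrite Rintegral_cst// -[fine _]/(Lambda1 R p) /eta; field; rewrite gt_eqF//.
apply: le_Rintegral => //.
- exact: integrable_norm (integrableB mZ iF (iT tau)).
- exact: ic.
move=> z Zz; have [z1B z2B] := Z1_sub Zz.
have td2 : 0 < tau < d by rewrite t0 td.
have t01 : 0 < tau <= 1 by rewrite t0 t1.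
have e101 : 0 < e1 <= 1 by rewrite e10 e11.
apply: (le_trans (product_remainder M1 t01 e101 fM (L1B _ Zz) (L2B _ Zz) (Q1B _ Zz) (Q2B _ Zz)
  (dP _ td2 _ z1B) (dP _ td2 _ z2B))).
rewrite ler_wpM2l ?(ltW t20)//; lra.
Unshelve. all: by end_near. Qed.

End second_order.

Theorem theorem2p1 (R : realType) (p : nat) (hp : (1 <= p)%N)
    (P : probability 'rV[R]_p R) (f : 'rV[R]_p -> R)
    (hac : P `<< lebesgue_rV R p) (hf : is_density P f) :
  (({ae lebesgue_rV R p, forall x,
       (tau ^+ (2 * p) * Lambda1 R p)^-1 * LLD P x tau%:E
         @[tau --> 0^'+] --> f x ^+ 2})
   /\ (continuous f -> forall x,
       (tau ^+ (2 * p) * Lambda1 R p)^-1 * LLD P x tau%:E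
         @[tau --> 0^'+] --> f x ^+ 2))
  /\ (Cdiff 3 f -> forall x,
       (tau ^+ 2)^-1 *
         ((tau ^+ (2 * p))^-1 * LLD P x tau%:E - Lambda1 R p * f x ^+ 2)
         @[tau --> 0^'+] --> hfun f x).
Proof.
split; [split|].
- apply: filterS (ae_lebesgue_point (density_integrable hf)) => x.
  exact: cvg_LLD_lebesgue_point.
- move=> fc x; apply: cvg_LLD_lebesgue_point => //.
  by apply: continuous_lebesgue_point; [have [] := hf|exact: fc].
- by move=> /CdiffS Cf x; exact: cvg_LLD_second_order.
Qed.
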